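(* Let $\Omega$ be a bounded open subset of $\mathbb{R}^{d_0}$ and let $X$ be a reflexive Banach space with $1$-symmetric basis. Then the identity $I:L^1(\Omega)\to JF_X(\Omega)$ is a Dunford-Pettis and strictly singular operator.
   Context: Let $X$ be a (infinite-dimensional, real) reflexive Banach space with norm $\|\cdot\|_X$ and a $1$-symmetric basis $(e_n)_{n}$, i.e. $\|\sum_n \epsilon_n a_n e_{\pi(n)}\|_X=\|\sum_n a_n e_n\|_X$ for all finitely supported real $(a_n)$, all signs $\epsilon_n\in\{-1,1\}$ and all permutations $\pi$ of $\mathbb{N}$. For a (nonempty) bounded open set $\Omega\subset\mathbb{R}^{d_0}$, $\mathcal{P}(\Omega)$ denotes the set of all open parallelepipeds $T=\prod_{d=1}^{d_0}(\alpha_d,\beta_d)$, $\alpha_d<\beta_d$, with $T\subset\Omega$. With $\mu$ Lebesgue measure, $JF_X(\Omega)$ is the completion of $L^1(\Omega)$ under the norm $\|f\|_{JF_X(\Omega)}=\sup\{\|\sum_{j=1}^m(\int_{T_j}f\,d\mu)e_j\|_X : m\in\mathbb{N},\ T_1,\dots,T_m\in\mathcal{P}(\Omega)\text{ pairwise disjoint}\}$; $I$ is the formal inclusion of $L^1(\Omega)$ (with its usual norm) into this completion. An operator is Dunford-Pettis if it maps weakly compact sets to norm compact sets; it is strictly singular if its restriction to any infinite-dimensional closed subspace is not an isomorphism onto its image. *)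

(* Defs.v *)
From HB Require Import structures.
From mathcomp Require Import all_boot all_order all_algebra.
From mathcomp Require Import all_classical all_reals all_analysis.
From mathcomp Require Import measurable_realfun.

Set Implicit Arguments.
Unset Strict Implicit.
Unset Printing Implicit Defensive.

Import Order.TTheory GRing.Theory Num.Theory.
Import numFieldNormedType.Exports.

Local Open Scope classical_set_scope.
Local Open Scope ring_scope.

(* The library's L^1 is a bare type of classes of functions modulo almost
   everywhere equality; it is given here its structure of normed space. *)
Section L1.
Context d (T : measurableType d) (R : realType).
Variable mu : {measure set T -> \bar R}.

Local Notation L1 := (LspaceType1 mu).

Definition L1fun (f : L1) : T -> R := f.

Lemma L1_ext (f g : L1) : ae_eq mu setT (L1fun f) (L1fun g) -> f = g.
Proof.
rewrite /L1fun; move: f g => [f [[pf]]] [g [[pg]]] /= fg.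
have E : f = g.
  by rewrite -(reprK f) -(reprK g); apply/eqP; rewrite eqmodE; apply/asboolP.
subst g; have -> : pf = pg by exact: Prop_irrelevance.
by [].
Qed.

Lemma Lfun_L1 (f : L1) : L1fun f \in Lfun mu 1.
Proof.
case: f => f [[pf]]; rewrite inE /L1fun /=; apply/andP; split; rewrite inE //=.
exact: (@measurable_funPT _ _ T (measurableTypeR R) (repr f)).
Qed.

Lemma L1_exists (f : T -> R) : f \in Lfun mu 1 ->
  exists g : L1, ae_eq mu setT (L1fun g) f.
Proof.
move=> /[dup] /[!inE] /andP[/[!inE]/= mf nf] _.
pose F : {mfun T >-> measurableTypeR R} := HB.pack f (isMeasurableFun.Build _ _ T (measurableTypeR R) f mf).
pose g : {mfun_ mu, T >-> measurableTypeR R} := \pi_({mfun_ mu, T >-> measurableTypeR R})%qT F.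
have gf : ae_eq mu setT (g : T -> R) f.
  have : (repr g == F %[mod {mfun_ mu, T >-> measurableTypeR R}])%qT by rewrite reprK.
  by rewrite eqmodE => /asboolP.
have mg : measurable_fun setT (g : T -> R).
  exact: (@measurable_funPT _ _ T (measurableTypeR R) (repr g)).
have fg : finite_norm mu 1 (g : T -> R).
  apply: le_lt_trans nf; rewrite !Lnorm1.
  rewrite (@ge0_ae_eq_integral _ _ _ mu setT _ (fun x => `|(f x)%:E|%E)) //.
  - by apply: (measurableT_comp (@abse_measurable _ _)); exact/measurable_EFinP.
  - by apply: (measurableT_comp (@abse_measurable _ _)); exact/measurable_EFinP.
  - by apply: filterS gf => x /[apply] /= ->.
pose h : LspaceType mu (@lexx _ _ 1%E) :=
  HB.pack g (isFinLebesgue.Build _ _ _ mu 1%E (@lexx _ _ 1%E) g fg).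
by exists h.
Qed.

Definition L1class (f : T -> R) (hf : f \in Lfun mu 1) : L1 :=
  sval (cid (L1_exists hf)).

Lemma L1classE (f : T -> R) (hf : f \in Lfun mu 1) :
  ae_eq mu setT (L1fun (L1class hf)) f.
Proof. exact: svalP (cid (L1_exists hf)). Qed.

Fact L1_zero_subproof : cst 0 \in Lfun mu 1.
Proof. exact: (LfunP (cst 0 : LfunType mu (lexx 1%E))). Qed.

Fact L1_opp_subproof (f : L1) : \- L1fun f \in Lfun mu 1.
Proof. exact: (Lfun_oppr_closed (Lfun_L1 f)). Qed.

Fact L1_add_subproof (f g : L1) : L1fun f \+ L1fun g \in Lfun mu 1.
Proof.
exact: ((Lfun_addr_closed mu (lexx 1%E)).2 _ _ (Lfun_L1 f) (Lfun_L1 g)).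
Qed.

Fact L1_scale_subproof (a : R) (f : L1) : a \o* L1fun f \in Lfun mu 1.
Proof. by apply: Lfun_scale => //; exact: Lfun_L1. Qed.

Definition L1zero : L1 := L1class L1_zero_subproof.
Definition L1opp (f : L1) : L1 := L1class (L1_opp_subproof f).
Definition L1add (f g : L1) : L1 := L1class (L1_add_subproof f g).
Definition L1scale (a : R) (f : L1) : L1 := L1class (L1_scale_subproof a f).

Lemma L1zeroE : ae_eq mu setT (L1fun L1zero) (fun=> 0).
Proof. exact: L1classE. Qed.
Lemma L1oppE f : ae_eq mu setT (L1fun (L1opp f)) (fun x => - L1fun f x).
Proof. exact: L1classE. Qed.
Lemma L1addE f g :
  ae_eq mu setT (L1fun (L1add f g)) (fun x => L1fun f x + L1fun g x).
Proof. exact: L1classE. Qed.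
Lemma L1scaleE a f :
  ae_eq mu setT (L1fun (L1scale a f)) (fun x => a * L1fun f x).
Proof.
apply: ae_eq_trans (L1classE _) _; apply: aeW => x _ /=; exact: mulrC.
Qed.

HB.instance Definition _ := gen_eqMixin L1.
HB.instance Definition _ := gen_choiceMixin L1.

Let aeI (P Q : T -> Prop) : {ae mu, forall x, P x} -> {ae mu, forall x, Q x} ->
  {ae mu, forall x, P x /\ Q x}.
Proof. by move=> hP hQ; apply: filterS2 hP hQ. Qed.

Fact L1addA : associative L1add.
Proof.
move=> f g h; apply: L1_ext.
move: (aeI (L1addE f (L1add g h)) (L1addE g h))
  (aeI (L1addE (L1add f g) h) (L1addE f g)).
apply: filterS2 => x [+ +] [+ +] _ => /(_ I) -> /(_ I) -> /(_ I) -> /(_ I) ->.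
exact: addrA.
Qed.

Fact L1addC : commutative L1add.
Proof.
move=> f g; apply: L1_ext; move: (L1addE f g) (L1addE g f).
by apply: filterS2 => x + + _ => /(_ I) -> /(_ I) ->; exact: addrC.
Qed.

Fact L1add0 : left_id L1zero L1add.
Proof.
move=> f; apply: L1_ext; move: (L1addE L1zero f) L1zeroE.
by apply: filterS2 => x + + _ => /(_ I) -> /(_ I) ->; exact: add0r.
Qed.

Fact L1addN : left_inverse L1zero L1opp L1add.
Proof.
move=> f; apply: L1_ext; move: (L1addE (L1opp f) f) (L1oppE f) L1zeroE.
apply: filterS3 => x + + + _ => /(_ I) -> /(_ I) -> /(_ I) ->.
exact: addNr.
Qed.

HB.instance Definition _ := GRing.isZmodule.Build L1 L1addA L1addC L1add0 L1addN.

Fact L1scaleA a b f : L1scale a (L1scale b f) = L1scale (a * b) f.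
Proof.
apply: L1_ext.
move: (L1scaleE a (L1scale b f)) (L1scaleE b f) (L1scaleE (a * b) f).
apply: filterS3 => x + + + _ => /(_ I) -> /(_ I) -> /(_ I) ->.
exact: mulrA.
Qed.

Fact L1scale1 : left_id 1 L1scale.
Proof.
move=> f; apply: L1_ext; move: (L1scaleE 1 f).
by apply: filterS => x + _ => /(_ I) ->; exact: mul1r.
Qed.

Fact L1scaleDr : right_distributive L1scale +%R.
Proof.
move=> a f g; apply: L1_ext.
move: (aeI (L1scaleE a (L1add f g)) (L1addE f g))
  (L1addE (L1scale a f) (L1scale a g)) (aeI (L1scaleE a f) (L1scaleE a g)).
apply: filterS3 => x [+ +] + [+ +] _.
move=> /(_ I) -> /(_ I) -> /(_ I) -> /(_ I) -> /(_ I) ->.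
exact: mulrDr.
Qed.

Fact L1scaleDl f : {morph L1scale^~ f : a b / a + b}.
Proof.
move=> a b; apply: L1_ext.
move: (L1scaleE (a + b) f) (L1addE (L1scale a f) (L1scale b f))
  (aeI (L1scaleE a f) (L1scaleE b f)).
apply: filterS3 => x + + [+ +] _ => /(_ I) -> /(_ I) -> /(_ I) -> /(_ I) ->.
exact: mulrDl.
Qed.

HB.instance Definition _ := GRing.Zmodule_isLmodule.Build R L1
  L1scaleA L1scale1 L1scaleDr L1scaleDl.

Definition L1norm (f : L1) : R := fine ('N[mu]_1[EFin \o L1fun f]).

Lemma L1norm_EFin f : (L1norm f)%:E = (\int[mu]_x `|(L1fun f x)%:E|)%E.
Proof.
have /integrableP[_ ] := (Lfun1_integrable mu (L1fun f)).1 (Lfun_L1 f).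
move=> h; rewrite /L1norm Lnorm1 fineK// ge0_fin_numE//; exact: integral_ge0.
Qed.

Lemma measurable_L1 f : measurable_fun setT (L1fun f).
Proof. by have := Lfun_L1 f; rewrite inE => /andP[/[!inE]]. Qed.

Let mL1 f : measurable_fun setT (fun x => `|(L1fun f x)%:E|%E).
Proof.
by apply: measurableT_comp => //; apply/measurable_EFinP; exact: measurable_L1.
Qed.

Fact ler_L1normD (f g : L1) : L1norm (f + g) <= L1norm f + L1norm g.
Proof.
rewrite -lee_fin EFinD !L1norm_EFin -ge0_integralD//.
have -> : (\int[mu]_x `|(L1fun (f + g) x)%:E| =
           \int[mu]_x `|(L1fun f x + L1fun g x)%:E|)%E.
  apply: ge0_ae_eq_integral => //.
    apply: measurableT_comp => //; apply/measurable_EFinP.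
    by apply: measurable_funD; exact: measurable_L1.
  by apply: filterS (L1addE f g) => x + _ => /(_ I) ->.
apply: ge0_le_integral => //.
- apply: measurableT_comp => //; apply/measurable_EFinP.
  by apply: measurable_funD; exact: measurable_L1.
- exact: emeasurable_funD.
- by move=> x _; rewrite lee_fin ler_normD.
Qed.

Fact L1normZ (a : R) (f : L1) : L1norm (a *: f) = `|a| * L1norm f.
Proof.
apply: EFin_inj; rewrite EFinM !L1norm_EFin -ge0_integralZl//.
apply: ge0_ae_eq_integral => //.
  by apply: measurable_funeM.
by apply: filterS (L1scaleE a f) => x + _ => /(_ I) ->; rewrite EFinM abseM.
Qed.

Fact L1norm_eq0 (f : L1) : L1norm f = 0 -> f = 0.
Proof.
move=> f0; apply: L1_ext.
have : (\int[mu]_x `|(L1fun f x)%:E| = 0)%E by rewrite -L1norm_EFin f0.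
have mf : measurable_fun setT (EFin \o L1fun f).
  by apply/measurable_EFinP; exact: measurable_L1.
move=> /(ae_eq_integral_abs mu measurableT mf).
move/filterS2; apply; last exact: L1zeroE.
by move=> x /(_ I) [->] + _ => /(_ I) ->.
Qed.

HB.instance Definition _ := Lmodule_isNormed.Build R L1
  ler_L1normD L1normZ L1norm_eq0.

End L1.

Section Dual.
Context (R : realType) (E : normedModType R).

Definition dual_pred : {pred E -> R^o} :=
  [pred f | `[< linear f /\ continuous f >]].

Record dual : Type := Dual { dual_fun :> E -> R^o; _ : dual_fun \in dual_pred }.

HB.instance Definition _ := [isSub for dual_fun].
HB.instance Definition _ := gen_eqMixin dual.
HB.instance Definition _ := gen_choiceMixin dual.

Fact dual_submod_closed : submod_closed dual_pred.
Proof.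
split.
  apply/asboolP; split; last exact: cst_continuous.
  by move=> a x y /=; rewrite scaler0 addr0.
move=> c f g /asboolP[lf cf] /asboolP[lg cg]; apply/asboolP; split.
  move=> a x y; rewrite !fctE lf lg !scalerDr !scalerA mulrC -!addrA.
  by congr (_ + _); rewrite addrCA.
move=> x; apply: (@continuousD _ _ _ (c *: f) g); last exact: cg.
exact: (@continuousZr _ _ _ f c x (cf x)).
Qed.

HB.instance Definition _ := GRing.isSubmodClosed.Build R _ dual_pred
  dual_submod_closed.
HB.instance Definition _ := [SubChoice_isSubLmodule of dual by <:].

Lemma dual_linear (f : dual) : linear f.
Proof. by have /asboolP[] := valP f. Qed.

Lemma dual_continuous (f : dual) : continuous f.
Proof. by have /asboolP[] := valP f. Qed.

HB.instance Definition _ (f : dual) :=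
  GRing.isLinear.Build R E R^o _ (dual_fun f) (dual_linear f).

Lemma dualD (f g : dual) x : (f + g) x = f x + g x.
Proof. by []. Qed.

Lemma dualZ (a : R) (f : dual) x : (a *: f) x = a * f x.
Proof. by []. Qed.

Definition dual_norm (f : dual) : R :=
  sup [set `|f x| | x in [set x : E | `|x| <= 1]].

Lemma dual_norm_has_sup (f : dual) :
  has_sup [set `|f x| | x in [set x : E | `|x| <= 1]].
Proof.
split; first by exists `|f 0|; exists 0 => //=; rewrite normr0.
have /(bounded_funP f) : bounded_near f (nbhs (0 : E)).
  by apply/linear_bounded_continuous; exact: dual_continuous.
by move=> /(_ 1)[M hM]; exists M => _ [x x1 <-]; exact: hM.
Qed.

Lemma dual_norm_ub (f : dual) x : `|x| <= 1 -> `|f x| <= dual_norm f.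
Proof.
by move=> x1; apply: ub_le_sup; [case: (dual_norm_has_sup f)|exists x].
Qed.

Lemma dual_norm_le (f : dual) M :
  (forall x, `|x| <= 1 -> `|f x| <= M) -> dual_norm f <= M.
Proof.
move=> h; apply: ge_sup; first by case: (dual_norm_has_sup f).
by move=> _ [x x1 <-]; exact: h.
Qed.

Fact ler_dual_normD (f g : dual) :
  dual_norm (f + g) <= dual_norm f + dual_norm g.
Proof.
apply: dual_norm_le => x x1; rewrite dualD.
by apply: le_trans (ler_normD _ _) _; apply: lerD; exact: dual_norm_ub.
Qed.

Fact dual_normZ (a : R) (f : dual) : dual_norm (a *: f) = `|a| * dual_norm f.
Proof.
have le b g : dual_norm (b *: g) <= `|b| * dual_norm g.
  apply: dual_norm_le => x x1; rewrite dualZ normrM ler_wpM2l//.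
  exact: dual_norm_ub.
apply/eqP; rewrite eq_le le /=.
have [->|a0] := eqVneq a 0.
  rewrite normr0 mul0r; apply: le_trans (@dual_norm_ub _ 0 _) => //.
  by rewrite normr0.
rewrite mulrC -ler_pdivlMr ?normr_gt0// mulrC -normfV.
by rewrite -[X in dual_norm X <= _](scalerK a0); exact: le.
Qed.

Fact dual_norm_eq0 (f : dual) : dual_norm f = 0 -> f = 0.
Proof.
move=> f0; apply: val_inj; apply/funext => x /=.
have [->|x0] := eqVneq x 0; first exact: linear0.
have nx : `|x| != 0 by rewrite normr_eq0.
have : `|f (`|x|^-1 *: x)| <= dual_norm f.
  by apply: dual_norm_ub; rewrite normrZ normfV normr_id mulVf.
rewrite f0 normr_le0 linearZ /= scaler_eq0 invr_eq0 (negbTE nx) /=.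
by move/eqP.
Qed.

HB.instance Definition _ := Lmodule_isNormed.Build R dual
  ler_dual_normD dual_normZ dual_norm_eq0.

(* [E] with the coarsest topology making every element of [dual] continuous. *)
Definition weak : Type :=
  initial_topology (fun x : E => (fun f : dual => f x) : {ptws dual -> R^o}).
HB.instance Definition _ := Topological.on weak.

Definition weakly_compact (K : set E) := compact (K : set weak).

End Dual.

Definition reflexive_space (R : realType) (E : normedModType R) : Prop :=
  forall phi : dual (dual E), exists x : E, forall f : dual E, phi f = f x.

Lemma sigma_finite_prod d1 d2 (T1 : measurableType d1) (T2 : measurableType d2)
    (R : realType) (m1 : {sigma_finite_measure set T1 -> \bar R})
    (m2 : {sigma_finite_measure set T2 -> \bar R}) :
  sigma_finite setT (m1 \x m2)%E.
Proof.
have /sigma_finiteP[F [TF ndF Foo]] := sigma_finiteT m1.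
have /sigma_finiteP[G [TG ndG Goo]] := sigma_finiteT m2.
exists (fun n => F n `*` G n).
  rewrite -setXTT TF TG predeqE => -[x y]; split.
    move=> [/= [n _ Fnx] [k _ Gky]]; exists (maxn n k) => //; split.
    - by move: x Fnx; exact/subsetPset/ndF/leq_maxl.
    - by move: y Gky; exact/subsetPset/ndG/leq_maxr.
  by move=> [n _ []/= ? ?]; split; exists n.
move=> k; have [? ?] := Foo k; have [? ?] := Goo k.
split; first exact: measurableX.
by rewrite product_measure1E// lte_mul_pinfty// ge0_fin_numE.
Qed.

Section LebesgueTuple.
Context (R : realType).
Local Notation mR := (measurableTypeR R).
Local Notation leb1 := (@lebesgue_measure R : set mR -> \bar R).
Local Open Scope ereal_scope.

Definition tcons n (x : mR * n.-tuple mR) : n.+1.-tuple mR :=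
  [tuple of x.1 :: x.2].

Definition tuncons n (t : n.+1.-tuple mR) : mR * n.-tuple mR :=
  (thead t, [tuple of behead t]).

Lemma tconsK n : cancel (@tcons n) (@tuncons n).
Proof. by move=> [x t]; congr pair; apply: val_inj. Qed.

Lemma tunconsK n : cancel (@tuncons n) (@tcons n).
Proof. by move=> t; rewrite [RHS]tuple_eta; apply: val_inj. Qed.

Lemma measurable_tcons n : measurable_fun setT (@tcons n).
Proof. exact: measurable_cons. Qed.

Lemma measurable_tuncons n : measurable_fun setT (@tuncons n).
Proof.
by apply/measurable_fun_pairP; split;
  [exact: measurable_tnth|exact: measurable_behead].
Qed.

Definition lebesgue_tupleS n (m : {sigma_finite_measure set (n.-tuple mR) -> \bar R})
    : set (n.+1.-tuple mR) -> \bar R :=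
  pushforward (leb1 \x m) (@tcons n).

Section Step.
Context n (m : {sigma_finite_measure set (n.-tuple mR) -> \bar R}).
Local Notation mS := (lebesgue_tupleS m).

Let mS0 : mS set0 = 0.
Proof. by rewrite /lebesgue_tupleS /pushforward preimage_set0 measure0. Qed.

Let mS_ge0 A : 0 <= mS A.
Proof. by rewrite /lebesgue_tupleS /pushforward; exact: measure_ge0. Qed.

Let mS_sigma : semi_sigma_additive mS.
Proof.
have mt A : measurable A -> measurable (@tcons n @^-1` A).
  by move=> mA; rewrite -[X in measurable X]setTI; exact: measurable_tcons.
move=> F mF tF mUF; rewrite /lebesgue_tupleS /pushforward preimage_bigcup.
apply: measure_semi_sigma_additive.
- by move=> i; exact: mt.
- apply/trivIsetP => /= i j _ _ ij; rewrite -preimage_setI.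
  by move/trivIsetP : tF => /(_ _ _ _ _ ij) ->//; rewrite preimage_set0.
- by rewrite -preimage_bigcup; exact: mt.
Qed.

HB.instance Definition _ := isMeasure.Build _ _ _ mS mS0 mS_ge0 mS_sigma.

Let mS_sigma_finite : sigma_finite setT mS.
Proof.
have [F FT mF] := sigma_finite_prod leb1 m.
exists (fun k => @tuncons n @^-1` F k).
  by rewrite -preimage_bigcup -FT preimage_setT.
move=> k; have [mFk Fk] := mF k; split.
  by rewrite -[X in measurable X]setTI; exact: measurable_tuncons.
rewrite /= /lebesgue_tupleS /pushforward -comp_preimage.
rewrite (_ : _ @^-1` _ = F k)//.
by apply/seteqP; split => x /=; rewrite tconsK.
Qed.

HB.instance Definition _ := Measure_isSigmaFinite.Build _ _ _ mS mS_sigma_finite.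

End Step.

(* The n-fold product of the Lebesgue measure on R; R^0 is a point of mass 1. *)
Fixpoint lebesgue_tuple n : {sigma_finite_measure set (n.-tuple mR) -> \bar R} :=
  match n with
  | 0 => \d_([tuple] : 0.-tuple mR)
  | n'.+1 => lebesgue_tupleS (lebesgue_tuple n')
  end.

End LebesgueTuple.

Section LebesgueRow.
Context (R : realType) (n : nat).
Local Notation mR := (measurableTypeR R).
Local Notation borel_rV := (g_sigma_algebraType (@open 'rV[R]_n)).

Definition row_of_tuple (t : n.-tuple mR) : borel_rV := \row_i tnth t i.

Lemma measurable_row_of_tuple : measurable_fun setT row_of_tuple.
Proof.
apply: (measurability (@open 'rV[R]_n : set (set borel_rV))) => //.
move=> _ [U oU <-]; rewrite setTI.
pose V (qk : 'rV[rat]_n * nat) : set 'rV[R]_n :=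
  [set x | forall j, `|ratr (qk.1 ord0 j) - x ord0 j| < qk.2.+1%:R^-1].
have -> : row_of_tuple @^-1` U =
    \bigcup_(qk in [set qk | V qk `<=` U]) (row_of_tuple @^-1` V qk).
  apply/seteqP; split; last by move=> t [qk VU]; exact: VU.
  move=> t /= Ut; have : nbhs (row_of_tuple t) U by exact: open_nbhs_nbhs.
  move=> /nbhs_ballP[e /= e0 eU].
  have [k ke] : exists k : nat, k.+1%:R^-1 < e / 2.
    have e2 : 0 < e / 2 by rewrite divr_gt0.
    near \oo => k; exists k; near: k.
    exact: (near_infty_natSinv_lt (PosNum e2)).
  have qex j : exists q : rat, `|ratr q - tnth t j| < k.+1%:R^-1 :> R.
    have [|q] := @rat_in_itvoo R (tnth t j) (tnth t j + k.+1%:R^-1).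
      by rewrite ltrDl.
    rewrite in_itv /= => /andP[q1 q2]; exists q.
    by rewrite gtr0_norm ?subr_gt0// ltrBlDl.
  pose q := \row_j sval (cid (qex j)).
  exists (q, k) => /=.
    move=> x Vx; apply: eU; split=> // i j; rewrite (ord1 i).
    
    rewrite /ball /= (splitr e).
    apply: le_lt_trans (ler_distD (ratr (q ord0 j)) _ _) _.
    apply: ltrD; apply: lt_trans ke; last exact: Vx.
    rewrite /row_of_tuple !mxE distrC; exact: svalP (cid (qex j)).
  move=> j; rewrite /row_of_tuple !mxE; exact: svalP (cid (qex j)).
rewrite bigcup_mkcond; apply: countable_bigcupT_measurable => //.
move=> qk; case: ifP => // _.
rewrite (_ : row_of_tuple @^-1` _ = \bigcap_(j in [set: 'I_n])
   ((@tnth n mR ^~ j) @^-1` [set y : mR | `|ratr (qk.1 ord0 j) - y| < qk.2.+1%:R^-1])).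
  apply: fin_bigcap_measurable => // j _.
  rewrite -[X in measurable X]setTI; apply: measurable_tnth => //.
  have -> : [set y : mR | `|ratr (qk.1 ord0 j) - y| < qk.2.+1%:R^-1] =
      ball (ratr (qk.1 ord0 j) : R) qk.2.+1%:R^-1 by [].
  exact: measurable_ball.
apply/seteqP; split=> t /= h j; have := h j; first by rewrite /row_of_tuple mxE.
by move/(_ I); rewrite /row_of_tuple mxE.
Unshelve. all: by end_near. Qed.

(* The Borel sets of R^n suffice: every Lebesgue integrable function is almost
   everywhere equal to a Borel one, so L^1 does not depend on the completion. *)
Definition lebesgue_rV : set borel_rV -> \bar R :=
  pushforward (lebesgue_tuple R n) row_of_tuple.

Let m0 : lebesgue_rV set0 = 0%E.
Proof. by rewrite /lebesgue_rV /pushforward preimage_set0 measure0. Qed.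

Let m_ge0 A : (0 <= lebesgue_rV A)%E.
Proof. by rewrite /lebesgue_rV /pushforward; exact: measure_ge0. Qed.

Let m_sigma : semi_sigma_additive lebesgue_rV.
Proof.
have mt A : measurable A -> measurable (row_of_tuple @^-1` A).
  move=> mA; rewrite -[X in measurable X]setTI.
  exact: measurable_row_of_tuple.
move=> F mF tF mUF; rewrite /lebesgue_rV /pushforward preimage_bigcup.
apply: measure_semi_sigma_additive.
- by move=> i; exact: mt.
- apply/trivIsetP => /= i j _ _ ij; rewrite -preimage_setI.
  by move/trivIsetP : tF => /(_ _ _ _ _ ij) ->//; rewrite preimage_set0.
- by rewrite -preimage_bigcup; exact: mt.
Qed.

HB.instance Definition _ := isMeasure.Build _ _ _ lebesgue_rV m0 m_ge0 m_sigma.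

Lemma open_measurable_rV (U : set 'rV[R]_n) :
  open U -> measurable (U : set borel_rV).
Proof. exact: sub_sigma_algebra. Qed.

Definition open_box (a b : 'rV[R]_n) : set 'rV[R]_n :=
  [set x | forall i, (a ord0 i < x ord0 i < b ord0 i)%R].

End LebesgueRow.

Section LebesgueBox.
Context (R : realType).
Local Notation mR := (measurableTypeR R).
Local Open Scope ereal_scope.

Let tbox n (a b : 'I_n -> R) : set (n.-tuple mR) :=
  [set t | forall i, (a i < tnth t i < b i)%R].

Let measurable_tbox n (a b : 'I_n -> R) : measurable (tbox a b).
Proof.
rewrite (_ : tbox a b = \bigcap_(i in [set: 'I_n])
    ((@tnth n mR ^~ i) @^-1` `]a i, b i[%classic)).
  apply: fin_bigcap_measurable => // i _.
  rewrite -[X in measurable X]setTI; apply: measurable_tnth => //.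
apply/seteqP; split=> t /= h i; have := h i; rewrite /= in_itv//=.
by move=> /(_ I).
Qed.

Let lebesgue_tbox n (a b : 'I_n -> R) : (forall i, a i <= b i)%R ->
  lebesgue_tuple R n (tbox a b) = (\prod_i (b i - a i))%:E.
Proof.
elim: n a b => [|n IH] a b ab.
  by rewrite big_ord0 /= diracE mem_set// => -[].
rewrite big_ord_recl EFinM /= /lebesgue_tupleS /pushforward.
rewrite (_ : _ @^-1` _ = `]a ord0, b ord0[%classic `*`
    tbox (a \o lift ord0) (b \o lift ord0)).
  rewrite [LHS]product_measure1E//; last exact: measurable_tbox.
  rewrite [X in _ * X = _](IH (a \o lift ord0) (b \o lift ord0)); last first.
    by move=> i; exact: ab.
  congr (_ * _); rewrite [LHS](lebesgue_measure_itv `]a ord0, b ord0[) /= lte_fin.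
  have := ab ord0; rewrite le_eqVlt => /orP[/eqP->|->//].
  by rewrite ltxx subrr.
apply/seteqP; split=> [[x t] /= h|[x t] [/= hx ht] i].
  split; first by have := h ord0; rewrite /= in_itv.
  by move=> i; have := h (lift ord0 i); rewrite /tcons tnthS.
case: (unliftP ord0 i) => [j|] ->; last by move: hx; rewrite in_itv.
by rewrite /tcons tnthS; exact: ht.
Qed.

Lemma lebesgue_rV_open_box n (a b : 'rV[R]_n) :
  (forall i, a ord0 i <= b ord0 i)%R ->
  lebesgue_rV (open_box a b) = (\prod_i (b ord0 i - a ord0 i))%:E.
Proof.
move=> ab; rewrite -lebesgue_tbox// /lebesgue_rV /pushforward; congr (_ _).
by apply/seteqP; split=> t /= h i; have := h i; rewrite /row_of_tuple mxE.
Qed.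

End LebesgueBox.

Section Bases.
Context (R : realType) (X : normedModType R).

Definition schauder_basis (e : nat -> X) : Prop :=
  forall x : X, exists! a : nat -> R,
    series (fun n => a n *: e n) @ \oo --> x.

(* A finitely supported scalar sequence is given by [a : nat -> R] cut at [N]. *)
Definition one_symmetric (e : nat -> X) : Prop :=
  forall (N : nat) (a : nat -> R) (eps : nat -> bool) (pi : nat -> nat),
    bijective pi ->
    `| \sum_(n < N) ((-1) ^+ eps n * a n) *: e (pi n) | =
    `| \sum_(n < N) a n *: e n |.

End Bases.

Section Operators.
Context (R : realType) (E F : normedModType R).

Definition dunford_pettis (T : E -> F) : Prop :=
  forall K : set E, weakly_compact K -> compact (T @` K).

Definition infinite_dimensional (Y : {pred E}) : Prop :=
  ~ exists (n : nat) (v : 'I_n -> E), (forall i, v i \in Y) /\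
      forall y, y \in Y -> exists c : 'I_n -> R, y = \sum_i c i *: v i.

Definition isomorphism_onto_image (T : E -> F) (Y : {pred E}) : Prop :=
  {within [set` Y], continuous T} /\
  exists S : F -> E,
    {in Y, cancel T S} /\ {within T @` [set` Y], continuous S}.

Definition strictly_singular (T : E -> F) : Prop :=
  forall Y : {pred E}, submod_closed Y -> closed [set` Y] ->
    infinite_dimensional Y -> ~ isomorphism_onto_image T Y.

End Operators.

(* [F], together with [i], is a completion of the vector space [E] for the norm
   [N]; such a completion is unique up to an isometry commuting with the
   inclusions. The norm carried by [E] itself plays no role here. *)
Definition is_completion_for (R : realType) (E : normedModType R)
    (F : completeNormedModType R) (N : E -> \bar R) (i : {linear E -> F}) : Prop :=
  (forall x, `|i x|%:E = N x) /\ dense (range i).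

Section JF.
Context (R : realType) (d : nat) (Omega : set 'rV[R]_d) (oO : open Omega).

(* Classes are taken with respect to Lebesgue measure restricted to Omega, so
   this is L^1(Omega), each class being represented by Borel functions on the
   whole space whose values outside Omega are irrelevant. *)
Definition L1_on : Type :=
  LspaceType1 (mrestr (@lebesgue_rV R d) (open_measurable_rV oO)).
HB.instance Definition _ := NormedModule.on L1_on.

Definition parallelepipeds : set (set 'rV[R]_d) :=
  [set T | exists a b : 'rV[R]_d,
    [/\ forall i, a ord0 i < b ord0 i, T = open_box a b & T `<=` Omega]].

(* The integrals do not depend on the representative [L1fun f], since each
   [T j] is included in Omega. *)
Definition JFnorm (X : normedModType R) (e : nat -> X) (f : L1_on) : \bar R :=
  ereal_sup [set r | exists (m : nat) (T : 'I_m -> set 'rV[R]_d),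
    [/\ forall j, parallelepipeds (T j), trivIset setT T &
      r = `| \sum_(j < m)
               (\int[@lebesgue_rV R d]_(x in T j) L1fun f x) *: e j |%:E]].

End JF.

(* Main.v *)
(* Write D(g) for the supremum of |int_T g| over the boxes T in Omega. A
   reflexive X is not l^1, so the norm of e_0 + ... + e_(n-1) is o(n); hence
   |I g| is small as soon as D(g) is small and |g|_1 is bounded, and it suffices
   to study D.

   Entropy: for a finite measure nu, a box is determined up to a set of small
   nu-measure by finitely many bits (the rounded values of the distribution
   functions of the marginals at its end points), and the number of bits does
   not depend on nu.

   Dunford-Pettis: a weakly compact K is equi-integrable (gliding hump), so by
   the entropy bound for the Lebesgue measure D(f - f0) is controlled on K by
   finitely many functionals, and I is weak-to-norm continuous on K.

   Strict singularity: suppose D(f) >= th |f|_1 on an infinite-dimensional Y. If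
   the unit ball of Y is equi-integrable, a unit vector of Y annihilating the
   finitely many representative boxes has small D. Otherwise Y contains unit
   vectors f_k of mass at least r on disjoint sets B_k; suitable signs give
   |+-f_0 ... +-f_(n-1)|_1 >= r n while D(+-f_0 ... +-f_(n-1)) = o(n), by the
   entropy bound for nu = (|f_0| + ... + |f_(n-1)|)/n. *)
Require Import Defs.
From HB Require Import structures.
From mathcomp Require Import all_boot all_order all_algebra.
From mathcomp Require Import all_classical all_reals all_analysis.
From mathcomp Require Import measurable_realfun lra ring zify.

Set Implicit Arguments.
Unset Strict Implicit.
Unset Printing Implicit Defensive.

Import Order.TTheory GRing.Theory Num.Theory.
Import numFieldNormedType.Exports.

Local Open Scope classical_set_scope.
Local Open Scope ring_scope.

(** * Symmetric bases *)

Section OneSymmetric.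
Context (R : realType) (X : normedModType R) (e : nat -> X).
Hypothesis e_sym : one_symmetric e.

(** The permutations in [one_symmetric] act on all of nat, so a finite injection has to be extended:
    [s] is followed by the missing values below a bound [M], and everything from [M] on is fixed. *)
Lemma nat_perm_extension (s : seq nat) : uniq s ->
  exists2 p : nat -> nat, bijective p &
    forall i, (i < size s)%N -> p i = nth 0%N s i.
Proof.
move=> us; set M := (\max_(x <- s) x).+1.
have sM x : x \in s -> (x < M)%N by move=> xs; rewrite ltnS leq_bigmax_seq.
pose t := s ++ [seq x <- iota 0 M | x \notin s].
have ut : uniq t.
  rewrite cat_uniq us filter_uniq ?iota_uniq// andbT.
  by apply/hasP => -[x]; rewrite mem_filter => /andP[/negP].
have mt x : (x \in t) = (x < M)%N.
  rewrite mem_cat mem_filter mem_iota add0n leq0n /=.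
  by have [/sM|//] := boolP (x \in s).
have st : size t = M.
  rewrite -(size_iota 0 M); apply/perm_size/uniq_perm => //.
    exact: iota_uniq.
  by move=> x; rewrite mt mem_iota.
exists (fun x => if (x < M)%N then nth 0%N t x else x).
  exists (fun x => if (x < M)%N then index x t else x) => x.
    have [xM|xM] := ltnP x M; last by rewrite ltnNge xM.
    by rewrite -mt mem_nth ?st// index_uniq ?st.
  have [xM|xM] := ltnP x M; last by rewrite ltnNge xM.
  by rewrite -st index_mem mt xM nth_index// mt.
move=> i si; rewrite -st size_cat (leq_trans si) ?leq_addr//.
by rewrite nth_cat si.
Qed.

Lemma norm_sum_perm (s : seq nat) (a : nat -> R) : uniq s ->
  `|\sum_(i < size s) a i *: e (nth 0%N s i)| =
  `|\sum_(i < size s) a i *: e i|.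
Proof.
move=> us; have [p bp ps] := nat_perm_extension us.
rewrite -(e_sym (size s) a (fun=> false) bp); congr `|_|.
by apply: eq_bigr => i _; rewrite ps// mul1r.
Qed.

Lemma norm_sum_abs n (a : nat -> R) :
  `|\sum_(i < n) `|a i| *: e i| = `|\sum_(i < n) a i *: e i|.
Proof.
have bid : bijective (@id nat) by exists id.
rewrite -(e_sym n a (fun i => a i < 0) bid); congr `|_|.
by apply: eq_bigr => i _; rewrite -normrEsign.
Qed.

(** The fundamental function of the basis; reflexivity will enter only through its being o(n). *)
Definition fundamental n : R := `|\sum_(i < n) e i|.

Lemma norm_sum_uniq (s : seq nat) : uniq s ->
  `|\sum_(j <- s) e j| = fundamental (size s).
Proof.
move=> us; have := norm_sum_perm (fun=> 1) us.
under eq_bigr do rewrite scale1r; under [in RHS]eq_bigr do rewrite scale1r.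
by rewrite (big_nth 0%N) big_mkord => ->.
Qed.

Lemma norm_basis n : `|e n| = `|e 0%N|.
Proof.
have := @norm_sum_uniq [:: n] isT; have := @norm_sum_uniq [:: 0%N] isT.
by rewrite !big_seq1 => -> ->.
Qed.

(** Flipping the sign of the last vector keeps the norm, and the average of the two sums is the
    shorter sum. *)
Lemma fundamentalS n : fundamental n <= fundamental n.+1.
Proof.
have bid : bijective (@id nat) by exists id.
have h : fundamental n.+1 = `|\sum_(i < n) e i - e n|.
  rewrite /fundamental.
  have := e_sym n.+1 (fun=> 1) (fun i => i == n) bid.
  under [in RHS]eq_bigr do rewrite scale1r; move=> <-; congr `|_|.
  rewrite big_ord_recr /= eqxx expr1 mulr1 scaleN1r; congr (_ - _).
  by apply: eq_bigr => i _; rewrite ltn_eqF// expr0 mulr1 scale1r.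
have h' : fundamental n.+1 = `|\sum_(i < n) e i + e n|.
  by rewrite /fundamental big_ord_recr.
have : `|(\sum_(i < n) e i - e n) + (\sum_(i < n) e i + e n)| <=
    fundamental n.+1 + fundamental n.+1.
  by rewrite {1}h h'; exact: ler_normD.
rewrite addrACA addNr addr0 -mulr2n -scaler_nat normrZ normr_nat.
by rewrite -/(fundamental n); lra.
Qed.

Lemma fundamental_le m n : (m <= n)%N -> fundamental m <= fundamental n.
Proof.
move/subnK <-; elim: (n - m)%N => // k IH.
by rewrite addSn; apply: le_trans (fundamentalS _).
Qed.

(** Cut [s] into blocks of [N] indices: the full blocks number at most [size s / N], and the
    remainder accounts for the [+ 1]. *)
Lemma norm_sum_uniq_le N (s : seq nat) : uniq s -> (0 < N)%N ->
  `|\sum_(j <- s) e j| <= ((size s)%:R / N%:R + 1) * fundamental N.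
Proof.
move=> + N0; have [k] := ubnP (size s); elim: k s => // k IH s.
rewrite ltnS => sk us.
have N0' : 0 < N%:R :> R by rewrite ltr0n.
have [sN|Ns] := leqP (size s) N.
  rewrite norm_sum_uniq//; apply: le_trans (fundamental_le sN) _.
  by rewrite ler_peMl// ?normr_ge0// lerDr divr_ge0.
rewrite -(cat_take_drop N s) big_cat /=; apply: le_trans (ler_normD _ _) _.
move: us; rewrite -{1}(cat_take_drop N s) cat_uniq => /and3P[ut _ ud].
have {ud} := IH _ _ ud; rewrite size_drop => /(_ _)/le_trans-IHd.
rewrite norm_sum_uniq// size_take Ns; set L := fundamental N.
have : `|\sum_(j <- drop N s) e j| <= ((size s)%:R / N%:R) * L.
  apply: IHd; first by lia.
  by rewrite natrB 1?ltnW// mulrBl divff ?gt_eqF// subrK.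
rewrite cat_take_drop; move: (_ / _) (`|_|) => x y; lra.
Qed.

Lemma exists_min_seq (a : nat -> R) (s : seq nat) : s != [::] ->
  exists2 j, j \in s & forall i, i \in s -> a j <= a i.
Proof.
elim: s => // x [_ _|y s /(_ isT)[j js IH] _].
  by exists x => [|i]; rewrite ?mem_head// inE => /eqP ->.
have [xj|/ltW jx] := leP (a x) (a j).
  exists x; first exact: mem_head.
  by move=> i; rewrite inE => /predU1P[->//|/IH]; exact: le_trans.
exists j; first by rewrite inE js orbT.
by move=> i; rewrite inE => /predU1P[->//|/IH].
Qed.

(* Peel off the multiple [a j] of the indicator of the support, where [a j] is
   the smallest coefficient: this shortens the support. *)
Lemma norm_sum_flat N (th : R) (a : nat -> R) (s : seq nat) : (0 < N)%N -> 0 <= th ->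
  uniq s -> (forall i, i \in s -> 0 <= a i <= th) ->
  `|\sum_(i <- s) a i *: e i| <=
    (th + (\sum_(i <- s) a i) / N%:R) * fundamental N.
Proof.
move=> N0; have [k] := ubnP (size s); elim: k s a th => // k IH s a th.
rewrite ltnS => sk th0 us ath.
have L0 : 0 <= fundamental N by exact: normr_ge0.
have [s0|sn0] := eqVneq s [::].
  by rewrite s0 !big_nil normr0 mul0r addr0 mulr_ge0.
have [j js ja] := exists_min_seq a sn0.
have /andP[aj0 ajth] := ath _ js.
have split_sum : \sum_(i <- s) a i *: e i =
    a j *: (\sum_(i <- s) e i) + \sum_(i <- rem j s) (a i - a j) *: e i.
  rewrite scaler_sumr (perm_big _ (perm_to_rem js)) /=.
  rewrite [in X in X + _](perm_big _ (perm_to_rem js)) /= !big_cons -addrA -big_split /=.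
  by congr (_ + _); apply: eq_bigr => i _; rewrite scalerBl addrC subrK.
rewrite split_sum; apply: le_trans (ler_normD _ _) _.
rewrite normrZ (ger0_norm aj0).
have := norm_sum_uniq_le us N0.
have {IH} : `|\sum_(i <- rem j s) (a i - a j) *: e i| <=
    (th - a j + (\sum_(i <- rem j s) (a i - a j)) / N%:R) * fundamental N.
  apply: (IH (rem j s) (fun i => a i - a j) (th - a j)).
  - by rewrite size_rem//; case: (s) sn0 sk.
  - by rewrite subr_ge0.
  - exact: rem_uniq.
  - move=> i /mem_rem iS; rewrite subr_ge0 lerD2r ja//=.
    by have /andP[] := ath _ iS.
(* The index [j] can be put back, since its new coefficient is 0. *)
have -> : \sum_(i <- rem j s) (a i - a j) = \sum_(i <- s) a i - a j * (size s)%:R.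
  transitivity (\sum_(i <- s) (a i - a j)).
    by rewrite [RHS](perm_big _ (perm_to_rem js)) /= big_cons subrr add0r.
  by rewrite sumrB big_const_seq count_predT iter_addr_0 mulr_natr.
have : 0 < N%:R :> R by rewrite ltr0n.
move=> N0' h1 h2; apply: le_trans (lerD (ler_wpM2l aj0 h2) h1) _.
(* The bound is exactly additive under the peeling: the terms [a j] and [a j * size s / N]
   cancel. *)
by rewrite le_eqVlt; apply/orP; left; apply/eqP; field; rewrite gt_eqF.
Qed.

Lemma norm_sum_le N (th : R) m (a : nat -> R) : (0 < N)%N -> 0 <= th ->
  (forall i, (i < m)%N -> `|a i| <= th) ->
  `|\sum_(i < m) a i *: e i| <=
    (th + (\sum_(i < m) `|a i|) / N%:R) * fundamental N.
Proof.
move=> N0 th0 ath; rewrite -norm_sum_abs.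
have := @norm_sum_flat N th (fun i => `|a i|) (index_iota 0 m) N0 th0 (iota_uniq _ _).
rewrite !big_mkord; apply=> i.
by rewrite mem_index_iota normr_ge0 /= => /ath.
Qed.

Lemma norm_sum_le1 m (a : nat -> R) :
  `|\sum_(i < m) a i *: e i| <= `|e 0%N| * \sum_(i < m) `|a i|.
Proof.
apply: le_trans (ler_norm_sum _ _ _) _; rewrite mulr_sumr ler_sum// => i _.
by rewrite normrZ norm_basis mulrC.
Qed.

(** Average over cyclic shifts of the coefficients [|a i|]: all shifts have the same norm, and they
    add up to a multiple of e_0 + ... + e_(n-1). *)
Lemma cyclic_average n (a : nat -> R) :
  (\sum_(i < n) `|a i|) * fundamental n <= n%:R * `|\sum_(i < n) a i *: e i|.
Proof.
case: n => [|n]; first by rewrite !big_ord0 mul0r mul0r.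
have -> : (\sum_(i < n.+1) `|a i|) * fundamental n.+1 =
    `|\sum_(s < n.+1) \sum_(i < n.+1) `|a i| *: e ((i + s)%R : 'I_n.+1)|.
  rewrite exchange_big /= -[X in X * _]ger0_norm ?sumr_ge0// -normrZ scaler_suml.
  congr `|_|; apply: eq_bigr => i _; rewrite -scaler_sumr; congr (_ *: _).
  by rewrite (reindex_inj (addrI i)).
apply: le_trans (ler_norm_sum _ _ _) _.
rewrite mulr_natl -[X in _ *+ X]card_ord -sumr_const; apply: ler_sum => s _.
pose t := [seq nat_of_ord (i + s)%R | i <- enum 'I_n.+1].
have ut : uniq t.
  rewrite map_inj_uniq ?enum_uniq// => i j /val_inj; exact: addIr.
have st : size t = n.+1 by rewrite size_map size_enum_ord.
have := norm_sum_perm (fun i => `|a i|) ut; rewrite st norm_sum_abs => <-.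
rewrite le_eqVlt; apply/orP; left; apply/eqP; congr `|_|; apply: eq_bigr => i _; congr (_ *: e _).
by rewrite (nth_map i) ?size_enum_ord// nth_ord_enum.
Qed.

End OneSymmetric.

(** * Reflexivity excludes l^1 *)

Section DualFacts.
Context (R : realType) (E : normedModType R).

Lemma linear_le_bounded (F : normedModType R) (f : {linear E -> F}) (M : R) :
  (forall x, `|f x| <= M * `|x|) -> continuous f.
Proof.
move=> fM; apply/linear_bounded_continuous/bounded_funP => r.
exists (`|M| * `|r|) => x xr; apply: le_trans (fM x) _.
apply: le_trans (ler_wpM2r (normr_ge0 x) (ler_norm M)) _.
by rewrite ler_wpM2l// (le_trans xr)// ler_norm.
Qed.

Lemma exists_dual (f : E -> R) (M : R) :
    (forall a x y, f (a *: x + y) = a * f x + f y) ->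
    (forall x, `|f x| <= M * `|x|) ->
  exists g : dual E, forall x, g x = f x.
Proof.
move=> lf fM.
have lf' : linear (f : E -> R^o) by move=> a x y; exact: lf.
pose F : {linear E -> R^o} := HB.pack (f : E -> R^o) (GRing.isLinear.Build R E R^o _ f lf').
have cF : continuous F by apply: (@linear_le_bounded _ F M).
have dF : (f : E -> R^o) \in @dual_pred R E by apply/asboolP; split.
by exists (@Dual R E _ dF).
Qed.

Lemma dual_le (f : dual E) x : `|f x| <= `|f| * `|x|.
Proof.
have [->|x0] := eqVneq x 0; first by rewrite linear0 !normr0 mulr0.
have nx : 0 < `|x| by rewrite normr_gt0.
rewrite -ler_pdivrMr// mulrC.
have := @dual_norm_ub _ _ f (`|x|^-1 *: x).
rewrite normrZ normfV normr_id mulVf ?gt_eqF// => /(_ (lexx _)).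
by rewrite linearZ /= normrZ normfV normr_id.
Qed.

End DualFacts.

(** Compactness of [[-M, M]] provides a cluster point, and a cluster point of an ultrafilter is a
    limit. *)
Lemma ultra_bounded_cvg (R : realType) (T : Type) (U : set_system T)
    (UU : UltraFilter U) (u : T -> R) (M : R) :
  (forall n, `|u n| <= M) -> cvg (u @ U).
Proof.
move=> uM; have PU : ProperFilter U by exact: ultra_proper.
have FU : ProperFilter (u @ U) by exact: fmap_proper_filter.
have [p clp] : exists p : R, cluster (u @ U) p.
  have [|p [_ clp]] := @segment_compact R (- M) M (u @ U); last by exists p.
  change (U (u @^-1` `[- M, M]%classic)).
  by apply: filterS (@filterT _ U _) => n _; rewrite /= in_itv /= -ler_norml.
apply/cvg_ex; exists p => A nA.
have [//|UcA] := in_ultra_setVsetC (u @^-1` A) UU.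
by have [y [? ?]] := clp (~` A) A UcA nA.
Qed.

Lemma bounded_series_cvg (R : realType) (u : nat -> R) (M : R) :
  (forall n, \sum_(i < n) `|u i| <= M) -> cvgn (series u).
Proof.
move=> uM; apply: normed_cvg; apply: nondecreasing_is_cvgn.
  by apply: nondecreasing_series => n _ _; exact: normr_ge0.
exists M => _ [n _ <-]; change (\sum_(0 <= i < n) `|u i| <= M).
by rewrite big_mkord.
Qed.

Section Reflexive.
Context (R : realType) (X : completeNormedModType R) (e : nat -> X).
Hypothesis e_basis : schauder_basis e.

Definition basis_coord (x : X) : nat -> R := sval (cid (e_basis x)).

Lemma basis_coord_cvg x : series (fun n => basis_coord x n *: e n) @ \oo --> x.
Proof. by rewrite /basis_coord; case: cid => a []. Qed.

Lemma basis_coord_unique x a :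
  series (fun n => a n *: e n) @ \oo --> x -> basis_coord x = a.
Proof. by move=> ha; rewrite /basis_coord; case: cid => b /= [_ h]; exact: h. Qed.

(** Linearity of the coordinates comes from the uniqueness of the expansion. *)
Lemma basis_coordD (c : R) x y n :
  basis_coord (c *: x + y) n = c * basis_coord x n + basis_coord y n.
Proof.
rewrite (@basis_coord_unique _ (fun n => c * basis_coord x n + basis_coord y n))//.
have -> : series (fun n => (c * basis_coord x n + basis_coord y n) *: e n) =
  (fun n => c *: series (fun n => basis_coord x n *: e n) n +
     series (fun n => basis_coord y n *: e n) n).
  apply/funext => k; rewrite /series /= scaler_sumr -big_split /=.
  by apply: eq_bigr => i _; rewrite scalerDl scalerA.
by apply: cvgD; [apply: cvgZr; exact: basis_coord_cvg|exact: basis_coord_cvg].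
Qed.

Lemma basis_coord_basis n k : basis_coord (e n) k = (k == n)%:R.
Proof.
rewrite (@basis_coord_unique _ (fun k => (k == n)%:R))//.
apply: cvg_near_cst; near=> m; rewrite /series /= big_mkord.
have nm : (n < m)%N by near: m; exact: nbhs_infty_gt.
rewrite (bigD1 (Ordinal nm)) //= eqxx scale1r big1 ?addr0// => i.
by rewrite -val_eqE /= => /negbTE ->; rewrite scale0r.
Unshelve. all: by end_near. Qed.

Section L1Bound.
Variable eta : R.
Hypothesis eta0 : 0 < eta.
Hypothesis eta_le : forall n (a : nat -> R),
  eta * (\sum_(i < n) `|a i|) <= `|\sum_(i < n) a i *: e i|.

(** The l^1 lower bound makes the coordinates absolutely summable, so bounded weights can be summed
    against them; the resulting functional has norm at most [eta^-1]. *)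
Lemma bounded_weight_functional (w : nat -> R) : (forall k, `|w k| <= 1) ->
  exists f : dual X, (forall n, f (e n) = w n) /\
    forall x, series (fun k => w k * basis_coord x k) @ \oo --> f x.
Proof.
move=> w1.
have le_coord x n : \sum_(i < n) `|w i * basis_coord x i| <=
    eta^-1 * `|series (fun k => basis_coord x k *: e k) n|.
  rewrite -ler_pdivrMl ?invr_gt0// invrK.
  apply: le_trans (_ : _ <= eta * \sum_(i < n) `|basis_coord x i|) _.
    rewrite ler_pM2l// ler_sum// => i _; rewrite normrM.
    by rewrite ler_piMl.
  by apply: le_trans (eta_le _ _) _; rewrite /series /= big_mkord.
have cvgw x : cvgn (series (fun k => w k * basis_coord x k)).
  have := cvg_seq_bounded (cvgP _ (@basis_coord_cvg x)).
  move=> [M [Mr hM]]; apply: (@bounded_series_cvg _ _ (eta^-1 * (M + 1))) => n.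
  apply: le_trans (le_coord x n) _; rewrite ler_pM2l ?invr_gt0//.
  by apply: hM => //; rewrite ltrDl.
pose f x := limn (series (fun k => w k * basis_coord x k)).
have [g gf] : exists g : dual X, forall x, g x = f x.
  apply: (@exists_dual _ _ f eta^-1) => [a x y|x].
    apply/cvg_lim => //.
    have -> : series (fun k => w k * basis_coord (a *: x + y) k) =
        (fun n => a * series (fun k => w k * basis_coord x k) n +
           series (fun k => w k * basis_coord y k) n).
      apply/funext => n; rewrite /series /= mulr_sumr -big_split /=.
      by apply: eq_bigr => i _; rewrite basis_coordD; ring.
    by apply: cvgD; [apply: cvgMr; exact: cvgw|exact: cvgw].
  have h1 : eta^-1 * `|series (fun k => basis_coord x k *: e k) n| @[n --> \oo]
      --> eta^-1 * `|x|.
    by apply: cvgMr; apply: cvg_norm; exact: basis_coord_cvg.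
  have h2 : `|series (fun k => w k * basis_coord x k) n| @[n --> \oo] --> `|f x|.
    by apply: cvg_norm; exact: cvgw.
  apply: (ler_cvg_to h2 h1); near=> n; apply: le_trans (le_coord x n).
  by rewrite {1}/series /= big_mkord; exact: ler_norm_sum.
exists g; split=> [n|x]; last by rewrite gf; exact: cvgw.
rewrite gf; apply/cvg_lim => //; apply: cvg_near_cst; near=> m.
have nm : (n < m)%N by near: m; exact: nbhs_infty_gt.
rewrite /series /= big_mkord (bigD1 (Ordinal nm)) //=.
rewrite basis_coord_basis eqxx mulr1 big1 ?addr0// => i.
by rewrite -val_eqE /= basis_coord_basis => /negbTE ->; rewrite mulr0.
Unshelve. all: by end_near. Qed.

(* The functional [f |-> lim_U f (e n)] on the dual, for a free ultrafilter [U],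
   is not an evaluation: the coordinates of the point would vanish, although the
   sum of the coordinates would be 1. *)
Lemma l1_bound_not_reflexive : one_symmetric e -> ~ reflexive_space X.
Proof.
move=> e_sym refl.
have [U [UU oU]] := @ultraFilterLemma nat \oo _.
have PU : ProperFilter U by exact: ultra_proper.
have fcvg (f : dual X) : cvg ((fun n => f (e n) : R) @ U).
  apply: (@ultra_bounded_cvg _ _ _ UU _ (`|f| * `|e 0%N|)) => n.
  by apply: le_trans (dual_le _ _) _; rewrite (norm_basis e_sym).
have [phi phiE] : exists phi : dual (dual X), forall f : dual X,
    phi f = lim ((fun n => f (e n) : R) @ U).
  apply: (@exists_dual _ (dual X) (fun f => lim ((fun n => f (e n) : R) @ U)) `|e 0%N|).
    move=> a f g; apply/cvg_lim => //.
    by apply: cvgD; [apply: cvgMr; exact: fcvg|exact: fcvg].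
  move=> f; apply: (cvgr_to_le (cvg_norm (fcvg f))).
  near=> n; apply: le_trans (dual_le _ _) _.
  by rewrite mulrC (norm_basis e_sym).
have [x xphi] := refl phi.
have limU (f : dual X) : (fun n => f (e n) : R) @ U --> f x.
  by rewrite -xphi phiE; exact: fcvg.
(* The [k]-th coordinate functional vanishes on [e n] for [n > k], so its limit along the free
   ultrafilter is 0. *)
have x0 k : basis_coord x k = 0.
  have [|f [fe fx]] := bounded_weight_functional (w := fun i => (i == k)%:R).
    by move=> i; case: (_ == _); rewrite ?normr1// normr0.
  have -> : basis_coord x k = f x.
    apply/esym; apply: (cvg_unique _ (fx x)) => //; apply: cvg_near_cst.
    near=> m; have km : (k < m)%N by near: m; exact: nbhs_infty_gt.
    rewrite /series /= big_mkord (bigD1 (Ordinal km)) //= eqxx mul1r.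
    rewrite big1 ?addr0// => i.
    by rewrite -val_eqE /= => /negbTE ->; rewrite mul0r.
  apply: (cvg_unique _ (limU f)) => //; apply: cvg_near_cst.
  apply: oU; near=> n; rewrite fe gtn_eqF//.
  by near: n; exact: nbhs_infty_gt.
have [|f [fe fx]] := bounded_weight_functional (w := fun=> 1).
  by move=> i; rewrite normr1.
have f0 : f x = 0.
  apply: (cvg_unique _ (fx x)) => //; apply: cvg_near_cst.
  by near=> m; rewrite /series /= big1// => i _; rewrite x0 mulr0.
have f1 : f x = 1.
  apply: (cvg_unique _ (limU f)) => //; apply: cvg_near_cst.
  by near=> n; rewrite fe.
by have := oner_neq0 R; rewrite -f1 f0 eqxx.
Unshelve. all: by end_near. Qed.

End L1Bound.

(** If the bound failed for every [N > 0], the average over cyclic shifts would turn this failure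
    into the l^1 lower bound, which reflexivity forbids. *)
Lemma reflexive_fundamental : reflexive_space X -> one_symmetric e ->
  forall eta : R, 0 < eta ->
  exists2 N, (0 < N)%N & fundamental e N <= eta * N%:R.
Proof.
move=> refl e_sym eta eta0; apply: contrapT => hN.
apply: (@l1_bound_not_reflexive eta eta0 _ e_sym refl) => n a.
have [->|n0] := posnP n; first by rewrite !big_ord0 mulr0.
have n0' : 0 < n%:R :> R by rewrite ltr0n.
rewrite -(ler_pM2l n0'); apply: le_trans (cyclic_average e_sym n a).
have -> x : n%:R * (eta * x) = x * (eta * n%:R) by ring.
rewrite ler_wpM2l ?sumr_ge0// leNgt; apply/negP => /ltW h.
by apply: hN; exists n.
Qed.

End Reflexive.

Lemma norm_sum_small (R : realType) (X : completeNormedModType R) (e : nat -> X) :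
  reflexive_space X -> schauder_basis e -> one_symmetric e ->
  forall C eta : R, 0 <= C -> 0 < eta -> exists2 th, 0 < th &
    forall m (a : nat -> R), (forall i, (i < m)%N -> `|a i| <= th) ->
      \sum_(i < m) `|a i| <= C -> `|\sum_(i < m) a i *: e i| <= eta.
Proof.
move=> refl bas e_sym C eta C0 eta0.
have C1 : 0 < C + 1 by rewrite ltr_wpDl.
have [N N0 hN] := reflexive_fundamental bas refl e_sym (divr_gt0 eta0 C1).
have N0' : 0 < N%:R :> R by rewrite ltr0n.
(* With this threshold [norm_sum_le] yields (1/N + C/N) * (eta/(C+1)) * N, which is [eta]. *)
exists (N%:R^-1) => [|m a am aC]; first by rewrite invr_gt0.
have Ni0 : 0 <= N%:R^-1 :> R by rewrite invr_ge0.
apply: le_trans (norm_sum_le e_sym N0 Ni0 am) _.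
apply: le_trans (_ : _ <= (N%:R^-1 + C / N%:R) * (eta / (C + 1) * N%:R)) _.
  apply: ler_pM => //; rewrite ?normr_ge0//.
    by rewrite addr_ge0 ?invr_ge0// divr_ge0// sumr_ge0.
  by rewrite lerD2l ler_pM2r ?invr_gt0.
rewrite le_eqVlt; apply/orP; left; apply/eqP; field.
by rewrite !gt_eqF.
Qed.

(** * Integrals of classes in L^1 *)

Section L1Facts.
Context d (T : measurableType d) (R : realType).
Variable mu : {measure set T -> \bar R}.
Local Notation L1 := (LspaceType1 mu).
Implicit Types (f g : L1) (h : T -> R) (A B : set T).

Definition nint A f : R := \int[mu]_(x in A) `|L1fun f x|.

(** The pairing with bounded functions, from which the functionals on L^1 are built. *)
Definition iint h f : R := \int[mu]_x (h x * L1fun f x).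

Lemma L1_integrable f A : measurable A -> mu.-integrable A (EFin \o L1fun f).
Proof.
move=> mA; apply: (@integrableS _ _ _ mu setT) => //.
exact: (Lfun1_integrable mu (L1fun f)).1 (Lfun_L1 f).
Qed.

Lemma L1_integrable_norm f A : measurable A ->
  mu.-integrable A (EFin \o (fun x => `|L1fun f x|)).
Proof. by move=> mA; apply: integrable_norm; exact: L1_integrable. Qed.

Lemma ae_eq_Rintegral A (u v : T -> R) : measurable A ->
  measurable_fun A u -> measurable_fun A v -> ae_eq mu setT u v ->
  \int[mu]_(x in A) u x = \int[mu]_(x in A) v x.
Proof.
move=> mA mu_ mv uv; congr fine; apply: ae_eq_integral => //.
- exact/measurable_EFinP.
- exact/measurable_EFinP.
- apply: (ae_eq_subset (@subsetT _ A)).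
  by apply: filterS uv => x uvx xT; rewrite /= uvx.
Qed.

Lemma nint_ge0 A f : 0 <= nint A f.
Proof. by apply: Rintegral_ge0 => x _; exact: normr_ge0. Qed.

Lemma nint_setT f : nint setT f = `|f|.
Proof.
rewrite /nint /Rintegral /Num.Def.normr /= /L1norm Lnorm1.
by congr fine; apply: eq_integral.
Qed.

Lemma nint_setU A B f : measurable A -> measurable B -> A `&` B = set0 ->
  nint (A `|` B) f = nint A f + nint B f.
Proof.
move=> mA mB AB; apply: Rintegral_setU => //.
  by apply: L1_integrable_norm; exact: measurableU.
by apply/disj_setPS; rewrite AB.
Qed.

Lemma nint_le A B f : measurable A -> measurable B -> A `<=` B ->
  nint A f <= nint B f.
Proof.
move=> mA mB AB; rewrite -(setDUK AB) nint_setU ?lerDl ?nint_ge0//.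
- exact: measurableD.
- by rewrite setDE setICA setICr setI0.
Qed.

Lemma nint_le_norm A f : measurable A -> nint A f <= `|f|.
Proof. by move=> mA; rewrite -nint_setT; exact: nint_le. Qed.

Lemma nintD A f g : measurable A -> nint A (f + g) <= nint A f + nint A g.
Proof.
move=> mA; rewrite /nint -RintegralD//; [|exact: L1_integrable_norm..].
have mD : measurable_fun A (fun x => `|L1fun f x + L1fun g x|).
  apply: measurableT_comp => //; apply: measurable_funD.
    exact: (@measurable_funS _ _ _ _ setT _ _ _ (@subsetT _ A) (@measurable_L1 _ _ _ mu f)).
  exact: (@measurable_funS _ _ _ _ setT _ _ _ (@subsetT _ A) (@measurable_L1 _ _ _ mu g)).
rewrite (@ae_eq_Rintegral A (fun x => `|L1fun (f + g) x|) (fun x => `|L1fun f x + L1fun g x|)) //.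
- apply: le_Rintegral => //.
  + apply: (@integrable_norm _ _ _ mu A (L1fun f \+ L1fun g)).
    have := integrableD mA (L1_integrable f mA) (L1_integrable g mA).
    exact.
  + have := integrableD mA (L1_integrable_norm f mA) (L1_integrable_norm g mA).
    exact.
  + by move=> x _; exact: ler_normD.
- by case/integrableP : (L1_integrable_norm (f + g) mA) => /measurable_EFinP.
- by apply: filterS (L1addE f g) => x + xT => /(_ I) ->.
Qed.

Lemma nintZ A (c : R) f : measurable A -> nint A (c *: f) = `|c| * nint A f.
Proof.
move=> mA; rewrite /nint -RintegralZl//; last exact: L1_integrable_norm.
apply: ae_eq_Rintegral => //.
- by case/integrableP : (L1_integrable_norm (c *: f) mA) => /measurable_EFinP.
- by case/integrableP : (integrableZl mA `|c| (L1_integrable_norm f mA)) => /measurable_EFinP.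
- by apply: filterS (L1scaleE c f) => x + xT => /(_ I) ->; rewrite normrM.
Qed.

Lemma nintN A f : measurable A -> nint A (- f) = nint A f.
Proof. by move=> mA; rewrite -scaleN1r nintZ// normrN1 mul1r. Qed.

Lemma nintB A f g : measurable A -> nint A (f - g) <= nint A f + nint A g.
Proof. by move=> mA; rewrite -(nintN g mA); exact: nintD. Qed.

Definition unit_fun h := measurable_fun setT h /\ forall x, `|h x| <= 1.

Lemma iint_integrable h f : unit_fun h ->
  mu.-integrable setT (EFin \o (fun x => h x * L1fun f x)).
Proof.
move=> [mh h1].
have := @integrableMr _ _ _ mu setT measurableT h (EFin \o L1fun f) mh _
  (L1_integrable f measurableT).
apply; exists 1; split => // M M1 x _; exact: le_trans (h1 x) (ltW M1).
Qed.

Lemma iint_linear h (a : R) f g : unit_fun h ->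
  iint h (a *: f + g) = a * iint h f + iint h g.
Proof.
move=> hh; have mh := hh.1.
rewrite /iint -RintegralZl ?iint_integrable// -RintegralD//; last 2 first.
- exact: (integrableZl measurableT a (iint_integrable f hh)).
- exact: iint_integrable.
apply: ae_eq_Rintegral => //.
- by case/integrableP : (iint_integrable (a *: f + g) hh) => /measurable_EFinP.
- have := integrableD measurableT
    (integrableZl measurableT a (iint_integrable f hh)) (iint_integrable g hh).
  by case/integrableP => /measurable_EFinP.
- move: (L1addE (a *: f) g) (L1scaleE a f).
  by apply: filterS2 => x + + xT => /(_ I) -> /(_ I) ->; rewrite mulrDr mulrCA.
Qed.

Lemma iint_le A h f : measurable A -> unit_fun h -> (forall x, ~ A x -> h x = 0) ->
  `|iint h f| <= nint A f.
Proof.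
move=> mA hh hA; apply: le_trans (le_normr_Rintegral _ (iint_integrable f hh)) _ => //.
rewrite /nint [leRHS]Rintegral_mkcond; apply: le_Rintegral => //.
- exact: (integrable_norm (iint_integrable f hh)).
- have := (integrable_mkcond (EFin \o (fun x => `|L1fun f x|)) mA).1 (L1_integrable_norm f mA).
  by rewrite restrict_EFin.
- move=> x _; rewrite patchE; case: ifPn => [_|]; last first.
    by rewrite notin_setE => /hA ->; rewrite mul0r normr0.
  by rewrite normrM ler_piMl// hh.2.
Qed.

Lemma iint_indic A f : measurable A ->
  iint \1_A f = \int[mu]_(x in A) L1fun f x.
Proof.
move=> mA; rewrite /iint [RHS]Rintegral_mkcond; apply: eq_Rintegral => x _.
by rewrite patchE indicE; case: ifPn => _; rewrite ?mul1r ?mul0r.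
Qed.

Lemma unit_fun_indic A : measurable A -> unit_fun \1_A.
Proof.
move=> mA; split; first exact: measurable_indic.
by move=> x; rewrite indicE; case: (_ \in _); rewrite ?normr1 ?normr0.
Qed.

Lemma iintD h1 h2 f : unit_fun h1 -> unit_fun h2 ->
  iint (fun x => h1 x + h2 x) f = iint h1 f + iint h2 f.
Proof.
move=> u1 u2; rewrite /iint -RintegralD ?iint_integrable//.
by apply: eq_Rintegral => x _; rewrite mulrDl.
Qed.

Lemma iint_dual h : unit_fun h -> exists F : dual L1, forall f, F f = iint h f.
Proof.
move=> hh; apply: (@exists_dual _ _ _ 1) => [a f g|f]; first exact: iint_linear.
by rewrite mul1r -nint_setT; apply: iint_le => // x /(_ Logic.I).
Qed.

Lemma nint_small f (e : R) : 0 < e -> exists2 dl : R, 0 < dl &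
  forall A, measurable A -> (mu A < dl%:E)%E -> nint A f < e.
Proof.
move=> e0.
by have [dl [dl0 h]] := integral_normr_continuous (L1_integrable f measurableT) e0; exists dl.
Qed.

Lemma nint_sum n (B : nat -> set T) f : (forall i, measurable (B i)) ->
  trivIset setT B -> \sum_(i < n) nint (B i) f <= `|f|.
Proof.
move=> mB tB.
suff -> : \sum_(i < n) nint (B i) f = nint (\big[setU/set0]_(i < n) B i) f.
  by apply: nint_le_norm; apply: bigsetU_measurable.
elim: n => [|n IH]; first by rewrite !big_ord0 /nint Rintegral_set0.
rewrite !big_ord_recr /= IH nint_setU//; first exact: bigsetU_measurable.
rewrite -subset0 => x []; rewrite -bigcup_mkord => -[i /= ni Bi Bn].
have E : i = n by apply: tB => //; exists x.
by rewrite E ltnn in ni.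
Qed.

Hypothesis mu_fin : (mu setT < +oo)%E.

(** Continuity from above of the finite measure [mu], followed by absolute continuity of the
    integral. *)
Lemma nint_tail f (U : nat -> set T) (e : R) : (forall n, measurable (U n)) ->
  (forall m n, (m <= n)%N -> U n `<=` U m) -> \bigcap_n U n = set0 -> 0 < e ->
  exists n0, forall n, (n0 <= n)%N -> nint (U n) f < e.
Proof.
move=> mU dU U0 e0; have [dl dl0 hdl] := nint_small f e0.
have : (mu \o U) n @[n --> \oo] --> mu (\bigcap_n U n).
  apply: nonincreasing_cvg_mu => //.
  - apply: le_lt_trans mu_fin; apply: le_measure; rewrite ?inE//.
  - by rewrite U0.
  - by move=> m n mn; apply/subsetPset; exact: dU.
rewrite U0 measure0 => /(_ [set u | (u < dl%:E)%E] (open_ereal_lt' _)).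
rewrite lte_fin => /(_ dl0).
by move=> [n0 _ hn0]; exists n0 => n nn; apply: hdl => //; exact: hn0.
Qed.

End L1Facts.

(** * Weak compactness *)

Section WeakCompactness.
Context (R : realType) (E : normedModType R).

Lemma weak_continuous (F : dual E) : continuous (fun x : weak E => F x : R^o).
Proof.
move=> x; apply: (@continuous_comp (weak E) {ptws dual E -> R^o} R^o
  (fun y : weak E => (fun G : dual E => G y : R^o)) (proj F)).
  exact: initial_continuous.
exact: proj_continuous.
Qed.

Lemma weak_nbhs (s : seq (dual E)) (p : weak E) (r : R) : 0 < r ->
  nbhs p [set x : weak E | forall F, F \in s -> `|F x - F p| < r].
Proof.
move=> r0; elim: s => [|F s IH]; first by apply: filterS filterT.
have nF : nbhs p [set x : weak E | `|F p - F x| < r].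
  have := @weak_continuous F p; move/cvgrPdist_lt => /(_ _ r0); exact.
apply: filterS2 nF IH => x /= Fx sx G; rewrite inE => /predU1P[->|/sx//].
by rewrite distrC.
Qed.

(** A cluster point of the tails of the sequence. The index obtained depends on the finitely many
    functionals tested, so subsequences have to be built by induction. *)
Lemma weakly_compact_cluster (K : set E) (x : nat -> E) :
    weakly_compact K -> (forall n, K (x n)) ->
  exists2 p, K p & forall N (s : seq (dual E)) (r : R), 0 < r ->
    exists2 n, (N <= n)%N & forall F, F \in s -> `|F (x n) - F p| < r.
Proof.
move=> cK xK.
have [|p [Kp clp]] := cK ((x : nat -> weak E) @ \oo) _.
  by exists 0%N => // n _; exact: xK.
exists p => // N s r r0.
have [||y [[n Nn <-] /= hs]] := clp [set x n | n in [set n | (N <= n)%N]]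
    [set y : weak E | forall F, F \in s -> `|F y - F p| < r].
- by exists N => // n /= Nn; exists n.
- exact: weak_nbhs.
- by exists n.
Qed.

(* A gliding hump: along a subsequence [nu] the vectors [x (nu k) - p] see
   only the functional [c (nu k)], so that [H], the sum of the [c (nu k)], is
   bounded away from 0 on them, while a cluster point of that subsequence
   annihilates every [c (nu k)], hence [H] too. *)
Lemma weakly_compact_no_hump (K : set E) (x : nat -> E) (c : nat -> dual E)
    (t : nat -> E -> R) (r : R) :
    weakly_compact K -> (forall n, K (x n)) -> 0 < r ->
    (forall n, r <= c n (x n)) ->
    (forall f n, `|c n f| <= t n f) ->
    (forall f s, 0 < s -> exists n0, forall n, (n0 <= n)%N -> t n f < s) ->
    (forall nu : nat -> nat, (forall k, (nu k < nu k.+1)%N) ->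
      exists H : dual E, forall f k, `|H f - \sum_(i < k) c (nu i) f| <= t (nu k) f) ->
  False.
Proof.
move=> cK xK r0 cx ct t0 sumc.
have r8 : 0 < r / 8 by rewrite divr_gt0.
have [p Kp clp] := weakly_compact_cluster cK xK.
have [np tp] := t0 p _ r8.
(* The next index [m]: [x n - p] is negligible from [m] on, and [x m] agrees with [p] on all earlier
   functionals up to an error that can be added [n + 1] times. *)
have step n : exists m, [/\ (n < m)%N, (np <= m)%N,
    t m (x n - p) < r / 8 &
    forall j, (j <= n)%N -> `|c j (x m) - c j p| < r / 8 / n.+1%:R].
  have [M hM] := t0 (x n - p) _ r8.
  have e0 : 0 < r / 8 / n.+1%:R by rewrite divr_gt0.
  have [m mN hm] := clp (maxn n.+1 (maxn np M)) [seq c j | j <- iota 0 n.+1] _ e0.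
  move: mN; rewrite !geq_max => /and3P[nm npm Mm].
  exists m; split => //; first exact: hM.
  by move=> j jn; apply: hm; apply: map_f; rewrite mem_iota.
have [next hnext] := choice step.
pose nu k := iter k next (next 0%N).
have nuS k : nu k.+1 = next (nu k) by [].
have nu_lt k : (nu k < nu k.+1)%N by rewrite nuS; case: (hnext (nu k)).
have nu_ge k : (k <= nu k)%N by elim: k => // k IH; exact: leq_ltn_trans (nu_lt k).
have nu_np k : (np <= nu k)%N.
  by case: k => [|k]; [case: (hnext 0%N)|rewrite nuS; case: (hnext (nu k))].
have nu_mono i k : (i <= k)%N -> (nu i <= nu k)%N.
  move/subnK <-; elim: (k - i)%N => // l IH; rewrite addSn.
  exact: leq_trans IH (ltnW (nu_lt _)).
(* Since [k <= nu k], the error [r / 8 / (nu k + 1)] at index [k + 1] is at most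
   [r / 8 / (k + 1)]. *)
have cnu i k : (i < k)%N -> `|c (nu i) (x (nu k)) - c (nu i) p| < r / 8 / k%:R.
  case: k => // k ik; rewrite nuS; have [_ _ _ h] := hnext (nu k).
  apply: lt_le_trans (h _ (nu_mono _ _ _)) _ => //.
  by rewrite ler_pM2l// lef_pV2 ?posrE// ler_nat ltnS.
have [H hH] := sumc nu nu_lt.
(* The [k] earlier functionals cost at most r/8, the hump gives at least 7r/8, and the tail costs
   less than r/8. *)
have Hx k : r / 2 <= H (x (nu k)) - H p.
  have := hH (x (nu k) - p) k.+1; rewrite big_ord_recr /= => h1.
  have [_ _ /(le_lt_trans h1) + _] := hnext (nu k).
  have h2 : `|\sum_(i < k) c (nu i) (x (nu k) - p)| <= r / 8.
    apply: le_trans (ler_norm_sum _ _ _) _.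
    apply: le_trans (_ : _ <= \sum_(i < k) r / 8 / k%:R) _.
      by apply: ler_sum => i _; rewrite linearB ltW// cnu.
    rewrite sumr_const card_ord; have [->|k0] := posnP k.
      by rewrite mulr0n ltW.
    by rewrite -[leLHS]mulr_natr divfK// pnatr_eq0 -lt0n.
  have h3 : r - r / 8 <= c (nu k) (x (nu k) - p).
    rewrite linearB lerD ?cx// lerN2; apply: le_trans (ler_norm _) _.
    by apply: le_trans (ct _ _) _; apply/ltW/tp.
  move: h2; rewrite linearB ler_norml ltr_norml => /andP[? ?] /andP[? ?].
  by move: h3; lra.
have [q Kq clq] := weakly_compact_cluster cK (fun k => xK (nu k)).
(* Each fixed [c (nu i)] tends along the subsequence to its value at [p], and the cluster point [q]
   inherits this value. *)
have cq i : c (nu i) (q - p) = 0.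
  apply/eqP; rewrite -normr_le0; apply/ler_addgt0Pl => s s0; rewrite addr0.
  have s2 : 0 < s / 2 by rewrite divr_gt0.
  have [N hN] : exists N : nat, r / 8 / (s / 2) < N%:R.
    by exists (Num.truncn (r / 8 / (s / 2))).+1; exact: truncnS_gt.
  have [k] := clq (maxn N i.+1) [:: c (nu i)] _ s2.
  rewrite geq_max => /andP[Nk ik] /(_ _ (mem_head _ _)).
  have h := cnu _ _ ik.
  have k0 : 0 < k%:R :> R by rewrite ltr0n (leq_trans _ ik).
  have : r / 8 / k%:R < s / 2.
    rewrite ltr_pdivrMr// -ltr_pdivrMl// mulrC; apply: lt_le_trans hN _.
    by rewrite ler_nat.
  move: h; rewrite linearB /= !ltr_norml ler_norml => /andP[? ?] ? /andP[? ?].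
  by apply/andP; split; lra.
have r4 : 0 < r / 4 by rewrite divr_gt0.
have Hq : r / 4 <= H (q - p).
  have [k _ /(_ _ (mem_head _ _))] := clq 0%N [:: H] _ r4.
  have := Hx k; rewrite linearB /= ltr_norml => ? /andP[? ?].
  by lra.
(* The head of [H] vanishes on [q - p], so [H (q - p)] is at most a tail, which is below r/4. *)
have [n0 tq] := t0 (q - p) _ r4.
have := hH (q - p) n0; rewrite big1 ?subr0//.
move/le_lt_trans => /(_ _ (tq _ (nu_ge n0))); rewrite ltr_norml => /andP[_].
by rewrite ltNge Hq.
Qed.

End WeakCompactness.

(** * Equi-integrability of weakly compact sets *)

Section EquiIntegrability.
Context d (T : measurableType d) (R : realType).
Variable mu : {measure set T -> \bar R}.
Local Notation L1 := (LspaceType1 mu).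

Definition equi_integrable (K : set L1) : Prop :=
  forall r : R, 0 < r -> exists2 dl : R, 0 < dl &
    forall A f, measurable A -> (mu A < dl%:E)%E -> K f -> nint A f < r.

(** The bounds on the measures of the [A i] telescope. *)
Lemma measure_tail_le (A : nat -> set T) (dl : nat -> R) n :
  (forall i, measurable (A i)) -> (forall i, 0 <= dl i) ->
  (forall i, mu (A i) <= (dl i - dl i.+1)%:E)%E ->
  (mu (\bigcup_(i in ~` `I_n) A i) <= (dl n)%:E)%E.
Proof.
move=> mA dl0 Adl.
have mU : measurable (\bigcup_(i in ~` `I_n) A i) by exact: bigcup_measurable.
apply: le_trans (measure_sigma_subadditive_tail mu (N := n) mA mU (@subset_refl _ _)) _.
apply: lime_le; first by apply: is_cvg_nneseries => i _ _.
apply: nearW => k; have [kn|/ltnW nk] := leqP k n.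
  by rewrite big_geq// lee_fin.
apply: le_trans (_ : _ <= \sum_(n <= i < k) (dl i - dl i.+1)%:E)%E _.
  exact: lee_sum.
rewrite sumEFin lee_fin.
have -> : \sum_(n <= i < k) (dl i - dl i.+1) = dl n - dl k.
  under eq_bigr do rewrite -opprB.
  by rewrite sumrN telescope_sumr// opprB.
by rewrite lerBlDr lerDl.
Qed.

(** Choose successively small sets [A n] on which [f n] has mass at least [r], the later ones so
    small that together they carry less than r/2 of [f n]. Removing them from [A n] makes the sets
    disjoint and leaves mass r/2. *)
Lemma not_equi_integrable_bumps (K : set L1) : ~ equi_integrable K ->
  exists (r : R) (f : nat -> L1) (B : nat -> set T),
    [/\ 0 < r, forall n, K (f n), forall n, measurable (B n),
        trivIset setT B & forall n, r <= nint (B n) (f n)].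
Proof.
move=> nK.
have [r [r0 hr]] : exists r : R, 0 < r /\ forall dl : R, 0 < dl ->
    exists A f, [/\ measurable A, (mu A < dl%:E)%E, K f & r <= nint A f].
  apply: contrapT => h; apply: nK => r r0; apply: contrapT => h'; apply: h.
  exists r; split => // dl dl0; apply: contrapT => h''; apply: h'.
  exists dl => // A f mA Adl Kf; rewrite ltNge; apply/negP => rA.
  by apply: h''; exists A, f.
have r2 : 0 < r / 2 by rewrite divr_gt0.
(* Positivity of [dl] is moved inside so that [choice] applies; for other [dl] a dummy triple is
   returned. *)
have step (dl : R) : exists Afd : set T * L1 * R, 0 < dl ->
    [/\ measurable Afd.1.1, (mu Afd.1.1 <= (dl - Afd.2)%:E)%E,
        K Afd.1.2, r <= nint Afd.1.1 Afd.1.2 &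
        0 < Afd.2 /\ forall C, measurable C -> (mu C <= (Afd.2)%:E)%E ->
          nint C Afd.1.2 < r / 2].
  have [dl0|] := boolP (0 < dl); last first.
    by exists (set0, 0, 0).
  have dl2 : 0 < dl / 2 by rewrite divr_gt0.
  have [A [f [mA Adl Kf rA]]] := hr _ dl2.
  have [g g0 hg] := nint_small f r2.
  (* At most half of the budget [dl] is passed on, which leaves dl/2 for [A]; taking g/2 turns the
     strict bound below [g] into a non-strict one. *)
  exists (A, f, Num.min (dl / 2) (g / 2)) => _ /=; split => //.
  - apply: le_trans (ltW Adl) _; rewrite lee_fin.
    have : Num.min (dl / 2) (g / 2) <= dl / 2 by rewrite ge_min lexx.
    by move: (Num.min _ _) => m; lra.
  - split; first by rewrite lt_min dl2 divr_gt0.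
    move=> C mC Cm; apply: hg => //; apply: le_lt_trans Cm _.
    rewrite lte_fin gt_min [X in _ || X](_ : _ = true) ?orbT//.
    by rewrite ltr_pdivrMr// mulr2n mulrDr mulr1 ltrDl.
have [F hF] := choice step.
pose dl n := iter n (fun x => (F x).2) 1.
have dlS n : dl n.+1 = (F (dl n)).2 by [].
have dl0 n : 0 < dl n.
  by elim: n => // n IH; rewrite dlS; case: (hF _ IH) => _ _ _ _ [].
pose A n := (F (dl n)).1.1; pose f n := (F (dl n)).1.2.
pose U n := \bigcup_(i in ~` `I_n.+1) A i.
have mA n : measurable (A n) by case: (hF _ (dl0 n)).
have mU n : measurable (U n) by apply: bigcup_measurable.
have muU n : (mu (U n) <= (dl n.+1)%:E)%E.
  apply: measure_tail_le => //; first by move=> i; exact/ltW.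
  by move=> i; case: (hF _ (dl0 i)).
exists (r / 2), f, (fun n => A n `\` U n); split => //.
- by move=> n; case: (hF _ (dl0 n)).
- by move=> n; exact: measurableD.
- have disj i j : (i < j)%N -> (A i `\` U i) `&` (A j `\` U j) !=set0 -> False.
    move=> ij [x [[_ nU] [Aj _]]]; apply: nU; exists j => //=.
    by apply/negP; rewrite -leqNgt.
  move=> i j _ _ ne; have [ij|ji|//] := ltngtP i j.
    by case: (disj _ _ ij).
  by case: (disj _ _ ji); rewrite setIC.
- move=> n; have [_ _ _ rn [_ /(_ _ (mU n) (muU n)) h]] := hF _ (dl0 n).
  have h1 : nint (A n `&` U n) (f n) <= nint (U n) (f n).
    by apply: nint_le => //; exact: measurableI.
  have h2 : nint (A n) (f n) = nint (A n `&` U n) (f n) + nint (A n `\` U n) (f n).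
    rewrite -nint_setU ?setUIDK//.
    + exact: measurableI.
    + exact: measurableD.
    + by rewrite setDE setIACA setICr setI0.
  have := le_lt_trans h1 h; move: rn; rewrite -/(A n) -/(f n) h2.
  by lra.
Qed.

Definition sign_fun (P N : set T) (x : T) : R := \1_P x - \1_N x.

Lemma unit_fun_sign (P N : set T) : measurable P -> measurable N ->
  P `&` N = set0 -> unit_fun (sign_fun P N).
Proof.
move=> mP mN PN; split.
  by apply: measurable_funB; exact: measurable_indic.
move=> x; rewrite /sign_fun !indicE.
have [xP|_] := boolP (x \in P); have [xN|_] := boolP (x \in N).
- by rewrite subrr normr0.
- by rewrite subr0 normr1.
- by rewrite sub0r normrN normr1.
- by rewrite subr0 normr0.
Qed.

Hypothesis mu_fin : (mu setT < +oo)%E.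

(** The hump functional [c n] integrates against the sign of [f n] on [B n]. As the [B n] are
    disjoint, sums of these functionals are again pairings with sign functions, with tails
    controlled by the mass on the union of the later [B i]. *)
Lemma weakly_compact_equi_integrable (K : set L1) :
  weakly_compact K -> equi_integrable K.
Proof.
move=> cK; apply: contrapT => /not_equi_integrable_bumps.
move=> [r [f [B [r0 Kf mB tB rB]]]].
pose P n := B n `&` [set x | 0 < L1fun (f n) x].
pose N n := B n `&` [set x | L1fun (f n) x < 0].
pose U n := \bigcup_(i in ~` `I_n) B i.
have mP n : measurable (P n).
  apply: measurableI => //.
  have := @measurable_L1 _ _ _ mu (f n) measurableT `]0, +oo[%classic.
  rewrite setTI (_ : _ @^-1` _ = [set x | 0 < L1fun (f n) x]); first by apply.
  by apply/seteqP; split => x /=; rewrite in_itv /= andbT.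
have mN n : measurable (N n).
  apply: measurableI => //.
  have := @measurable_L1 _ _ _ mu (f n) measurableT `]-oo, 0[%classic.
  rewrite setTI (_ : _ @^-1` _ = [set x | L1fun (f n) x < 0]); first by apply.
  by apply/seteqP; split => x /=; rewrite in_itv /=.
have mU n : measurable (U n) by exact: bigcup_measurable.
have PN n : P n `&` N n = set0.
  by rewrite -subset0 => x [[_ /= h1] [_ /= h2]]; have := lt_trans h1 h2; rewrite ltxx.
have uf n : unit_fun (sign_fun (P n) (N n)) by exact: unit_fun_sign.
have /choice[c hc] n := iint_dual mu (uf n).
apply: (@weakly_compact_no_hump _ _ K f c (fun n => nint (U n)) r cK Kf r0).
- move=> n; apply: le_trans (rB n) _; rewrite hc /nint [leLHS]Rintegral_mkcond.
  rewrite le_eqVlt; apply/orP; left; apply/eqP; apply: eq_Rintegral => x _.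
  rewrite patchE /sign_fun !indicE; case: ifPn => [|]; rewrite ?inE ?notin_setE => xB.
    have [x0|x0|x0] := ltgtP (L1fun (f n) x) 0.
    + rewrite memNset ?mem_set//; last by move=> [_ /= /(lt_trans x0)]; rewrite ltxx.
      by rewrite sub0r mulN1r ltr0_norm.
    + rewrite mem_set// memNset; last by move=> [_ /= /(lt_trans x0)]; rewrite ltxx.
      by rewrite subr0 mul1r gtr0_norm.
    + by rewrite x0 normr0 mulr0.
  by rewrite !memNset ?subrr ?mul0r// => -[].
- move=> g n; rewrite hc; apply: iint_le => // x nU.
  rewrite /sign_fun !indicE !memNset ?subrr// => -[Bx _]; apply: nU.
    by exists n => //=; rewrite ltnn.
  by exists n => //=; rewrite ltnn.
- move=> g s s0; apply: (nint_tail mu_fin) => //.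
    move=> m n mn x [i /= ni Bi]; exists i => //= im; apply: ni; exact: leq_trans mn.
  rewrite -subset0 => x h; have [i _ Bi] := h 0%N Logic.I.
  have [j /= ji Bj] := h i.+1 Logic.I; apply: ji.
  have -> : j = i by apply: tB => //; exists x.
  exact: ltnSn.
- move=> nu nu_lt.
  have nu_mono i k : (i <= k)%N -> (nu i <= nu k)%N.
    move/subnK <-; elim: (k - i)%N => // l IH; rewrite addSn.
    exact: leq_trans IH (ltnW (nu_lt _)).
  have nu_inj i j x : B (nu i) x -> B (nu j) x -> i = j.
    move=> Bi Bj; have E : nu i = nu j by apply: tB => //; exists x.
    have [ij|ji|//] := ltngtP i j.
      by have := leq_trans (nu_lt i) (nu_mono _ _ ij); rewrite E ltnn.
    by have := leq_trans (nu_lt j) (nu_mono _ _ ji); rewrite E ltnn.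
  (* The tail of the series from [k] on is realised as a single sign function; [H] is the case
     [k = 0]. *)
  pose tP k := \bigcup_(i in ~` `I_k) P (nu i).
  pose tN k := \bigcup_(i in ~` `I_k) N (nu i).
  have mtP k : measurable (tP k) by exact: bigcup_measurable.
  have mtN k : measurable (tN k) by exact: bigcup_measurable.
  have ut k : unit_fun (sign_fun (tP k) (tN k)).
    apply: unit_fun_sign => //; rewrite -subset0 => x [[i _ Pi] [j _ Nj]].
    have E := nu_inj _ _ _ Pi.1 Nj.1; rewrite -E in Nj.
    by rewrite -(PN (nu i)).
  have indicS (Q : nat -> set T) k x : (forall i, Q i `<=` B i) ->
      \1_(\bigcup_(i in ~` `I_k) Q (nu i)) x =
      \1_(Q (nu k)) x + \1_(\bigcup_(i in ~` `I_k.+1) Q (nu i)) x :> R.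
    move=> QB; rewrite !indicE; have [Qx|nQx] := pselect (Q (nu k) x).
      rewrite (mem_set Qx) (@memNset _ (\bigcup_(i in ~` `I_k.+1) Q (nu i))) ?mulr0n ?addr0; last first.
        move=> [j /= kj Qj]; apply: kj.
        by rewrite (nu_inj _ _ _ (QB _ _ Qx) (QB _ _ Qj)).
      by rewrite mem_set//; exists k => //=; rewrite ltnn.
    rewrite (memNset nQx) add0r; congr (nat_of_bool _)%:R.
    apply/idP/idP; rewrite !inE => -[i /= ki Qi]; exists i => //=.
      move=> ik; apply: ki; rewrite ltn_neqAle -ltnS ik andbT.
      by apply/eqP => E; rewrite E in Qi.
    by move=> ik; apply: ki; rewrite (ltn_trans ik).
  have tS g k : iint (sign_fun (tP k) (tN k)) g =
      c (nu k) g + iint (sign_fun (tP k.+1) (tN k.+1)) g.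
    rewrite hc -iintD//; apply: eq_Rintegral => x _; congr (_ * _).
    rewrite /sign_fun indicS; last by move=> i y [].
    rewrite [\1_(tN k) x]indicS; last by move=> i y [].
    by rewrite opprD addrACA.
  have tsum g k : iint (sign_fun (tP 0%N) (tN 0%N)) g =
      \sum_(i < k) c (nu i) g + iint (sign_fun (tP k) (tN k)) g.
    elim: k => [|k IH]; first by rewrite big_ord0 add0r.
    by rewrite IH big_ord_recr /= -addrA -tS.
  have [H hH] := iint_dual mu (ut 0%N); exists H => g k.
  rewrite hH (tsum g k) addrAC subrr add0r; apply: iint_le => // x nU.
  have nu_ge i : ~ (i < k)%N -> ~ (nu i < nu k)%N.
    by move=> /negP; rewrite -leqNgt => /nu_mono h; apply/negP; rewrite -leqNgt.
  rewrite /sign_fun !indicE !memNset ?subrr// => -[i /= ki [Bi _]]; apply: nU.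
    by exists (nu i) => //=; exact: nu_ge.
  by exists (nu i) => //=; exact: nu_ge.
Qed.

End EquiIntegrability.

(** * Families of sets of uniform entropy *)

(** Each functional cuts [Y] down by at most one dimension, so the common kernel stays
    infinite-dimensional. *)
Lemma infinite_dimensional_kernel (R : realType) (E : normedModType R)
    (Y : {pred E}) (s : seq (dual E)) :
  submod_closed Y -> infinite_dimensional Y ->
  exists2 y, y \in Y & y != 0 /\ forall G, G \in s -> G y = 0.
Proof.
elim: s Y => [|G s IH] Y sY infY.
  apply: contrapT => h; apply: infY; exists 0%N, (fun=> 0); split; first by case.
  move=> y yY; exists (fun=> 0); rewrite big_ord0.
  by have [//|y0] := eqVneq y 0; case: h; exists y.
have [Y0 Ylin] := sY.
pose Y' : {pred E} := [pred y | (y \in Y) && (G y == 0)].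
have sY' : submod_closed Y'.
  split; first by rewrite inE Y0 linear0 eqxx.
  move=> a u v; rewrite !inE => /andP[uY /eqP Gu] /andP[vY /eqP Gv].
  by rewrite Ylin// linearD linearZ /= Gu Gv scaler0 addr0 eqxx.
have infY' : infinite_dimensional Y'.
  move=> [n [v [vY' spanv]]]; apply: infY.
  (* Either [G] vanishes on [Y], or some [z] with [G z != 0] completes a spanning family of the
     kernel to one of [Y]. *)
  have [[z zY Gz]|nz] := pselect (exists2 z, z \in Y & G z != 0); last first.
    exists n, v; split; first by move=> i; have := vY' i; rewrite inE => /andP[].
    move=> y yY; apply: spanv; rewrite inE yY /=.
    by have [//|Gy] := eqVneq (G y) 0; case: nz; exists y.
  exists n.+1, (fun i => oapp v z (unlift ord0 i)); split.
    move=> i; case: unliftP => [j _|_] //=.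
    by have := vY' j; rewrite inE => /andP[].
  move=> y yY; have [|c hc] := spanv (y - (G y / G z) *: z).
    rewrite inE addrC -scaleNr Ylin//= linearD linearZ /=.
    by rewrite -[_ *: _]/(_ * _) mulNr divfK// addNr.
  exists (fun i => oapp c (G y / G z) (unlift ord0 i)).
  rewrite big_ord_recl unlift_none /=.
  by under eq_bigr do rewrite liftK /=; rewrite -hc addrC subrK.
have [y] := IH Y' sY' infY'; rewrite inE => /andP[yY /eqP Gy] [y0 hy].
exists y => //; split => // H; rewrite inE => /predU1P[->//|]; exact: hy.
Qed.

Section SetFamily.
Context d (T : measurableType d) (R : realType).

(* The entropy of the family in L^1(nu) is bounded uniformly in the finite
   measures nu of mass at most C; [nu] need only be finitely additive. *)
Definition uniform_entropy (F : set (set T)) : Prop :=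
  forall C dl : R, 0 < dl -> exists n : nat, forall nu : set T -> R,
    (forall A, measurable A -> 0 <= nu A) ->
    (forall A B, measurable A -> measurable B -> A `&` B = set0 ->
      nu (A `|` B) = nu A + nu B) ->
    nu setT <= C ->
    exists rep : 'I_n -> set T, (forall i, measurable (rep i)) /\
      forall A, F A -> exists i, nu (A `\` rep i) + nu (rep i `\` A) <= dl.

Variable mu : {measure set T -> \bar R}.
Local Notation L1 := (LspaceType1 mu).
Hypothesis mu_fin : (mu setT < +oo)%E.

Definition sint (A : set T) (f : L1) : R := \int[mu]_(x in A) L1fun f x.

Lemma sint_linear A (a : R) (f g : L1) : measurable A ->
  sint A (a *: f + g) = a * sint A f + sint A g.
Proof.
by move=> mA; rewrite /sint -!iint_indic// iint_linear//; exact: unit_fun_indic.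
Qed.

Lemma sintD A (f g : L1) : measurable A -> sint A (f + g) = sint A f + sint A g.
Proof. by move=> mA; rewrite -{1}(scale1r f) sint_linear// mul1r. Qed.

Lemma sintB A (f g : L1) : measurable A -> sint A (f - g) = sint A f - sint A g.
Proof. by move=> mA; rewrite addrC -scaleN1r sint_linear// mulN1r addrC. Qed.

Lemma sint_dual A : measurable A -> exists G : dual L1, forall f, G f = sint A f.
Proof.
move=> mA; have [G hG] := iint_dual mu (unit_fun_indic R mA).
by exists G => f; rewrite hG iint_indic.
Qed.

Lemma sint_le_nint A (f : L1) : measurable A -> `|sint A f| <= nint A f.
Proof. by move=> mA; apply: le_normr_Rintegral => //; exact: L1_integrable. Qed.

Lemma sint_setU A B (f : L1) : measurable A -> measurable B -> A `&` B = set0 ->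
  sint (A `|` B) f = sint A f + sint B f.
Proof.
move=> mA mB AB; apply: Rintegral_setU => //.
  by apply: L1_integrable; exact: measurableU.
by apply/disj_setPS; rewrite AB.
Qed.

(** Both integrals contain the integral over the intersection. This is how a set is replaced by its
    entropy representative. *)
Lemma sint_diff A B (f : L1) : measurable A -> measurable B ->
  `|sint A f| <= `|sint B f| + (nint (A `\` B) f + nint (B `\` A) f).
Proof.
move=> mA mB; have mAB : measurable (A `&` B) by exact: measurableI.
have mD : measurable (A `\` B) by exact: measurableD.
have mD' : measurable (B `\` A) by exact: measurableD.
have eA : sint A f = sint (A `&` B) f + sint (A `\` B) f.
  by rewrite -sint_setU ?setUIDK// setDE setIACA setICr setI0.
have eB : sint B f = sint (A `&` B) f + sint (B `\` A) f.
  by rewrite setIC -sint_setU ?setUIDK//; [exact: measurableI|rewrite setDE setIACA setICr setI0].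
have -> : sint A f = sint B f + (sint (A `\` B) f - sint (B `\` A) f).
  by rewrite eA eB; ring.
apply: le_trans (ler_normD _ _) _; rewrite lerD2l.
apply: le_trans (ler_normB _ _) _; apply: lerD; exact: sint_le_nint.
Qed.

Let m (A : set T) : R := fine (mu A).

Let m_fin A : measurable A -> mu A \is a fin_num.
Proof. by move=> mA; apply: lty_fin_num_fun. Qed.

Let mE A : measurable A -> (m A)%:E = mu A.
Proof. by move=> mA; rewrite /m fineK// m_fin. Qed.

Let m_ge0 A : measurable A -> 0 <= m A.
Proof. by move=> mA; rewrite -lee_fin mE. Qed.

Let m_setU A B : measurable A -> measurable B -> A `&` B = set0 ->
  m (A `|` B) = m A + m B.
Proof.
move=> mA mB AB; apply: EFin_inj; rewrite EFinD !mE ?measureU//.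
exact: measurableU.
Qed.

(* Sets are merged as long as the measure of the pending union [P] remains
   below [dl / 2]: each of the groups so obtained carries at most 1 and, except
   for the last one, has measure at least [dl / 2]. *)
Lemma sum_sint_le (g : L1) (dl : R) (A : nat -> set T) n : 0 < dl ->
    (forall B, measurable B -> (mu B < dl%:E)%E -> nint B g <= 1) ->
    (forall i, measurable (A i)) -> trivIset setT A ->
    (forall i, (i < n)%N -> `|sint (A i) g| <= 1) ->
  \sum_(i < n) `|sint (A i) g| <= 2 / dl * m setT + 1.
Proof.
move=> dl0 hdl mA tA A1.
pose W k := \big[setU/set0]_(i < k) A i.
have mW k : measurable (W k) by exact: bigsetU_measurable.
have WA k : W k `&` A k = set0.
  rewrite -subset0 => x []; rewrite /W -bigcup_mkord => -[i /= ik Ai Ak].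
  have E : i = k by apply: tA => //; exists x.
  by rewrite E ltnn in ik.
have dl20 : 0 <= 2 / dl by rewrite divr_ge0// ltW.
(* [c] is the total of the closed groups and [w] a bound from below for the measure they occupy; [p]
   is the part of the sum pending on [P]. *)
have inv k : (k <= n)%N -> exists P w c p, [/\ measurable P /\ P `<=` W k,
    c <= 2 / dl * w, w + m P <= m (W k),
    \sum_(i < k) `|sint (A i) g| = c + p & p <= 1 /\ p <= nint P g \/
      p <= 1 /\ dl / 2 <= m P].
  elim: k => [|k IH] kn.
    exists set0, 0, 0, 0; split.
    - by split => //; exact: sub0set.
    - by rewrite mulr0.
    - by rewrite /W big_ord0 add0r.
    - by rewrite big_ord0 addr0.
    - by left; split => //; exact: nint_ge0.
  have [P [w [c [p [[mP PW] cw wP sE hp]]]]] := IH (ltnW kn).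
  have p1 : p <= 1 by case: hp => -[].
  have PA : P `&` A k = set0.
    by rewrite -subset0 -(WA k); apply: setSI.
  have WS : m (W k.+1) = m (W k) + m (A k).
    by rewrite [W k.+1]/W big_ord_recr /= -/(W k) m_setU.
  have PWS : P `<=` W k.+1.
    by rewrite /W big_ord_recr /=; exact: subset_trans (@subsetUl _ _ _).
  have AWS : A k `<=` W k.+1 by rewrite /W big_ord_recr /=.
  have a1 := A1 k kn; have aA := sint_le_nint g (mA k).
  set a := `|sint (A k) g| in a1 aA.
  have close x : dl / 2 <= x -> 1 <= 2 / dl * x.
    move=> hx; apply: le_trans (_ : _ <= 2 / dl * (dl / 2)) _.
      by rewrite le_eqVlt; apply/orP; left; apply/eqP; field; rewrite gt_eqF.
    by rewrite ler_wpM2l.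
  have [P2|P2] := leP (dl / 2) (m P).
    exists (A k), (w + m P), (c + p), a; split => //.
    - by rewrite mulrDr; have := close _ P2; lra.
    - by rewrite WS lerD2r.
    - by rewrite big_ord_recr /= sE.
    - by left.
  have [A2|A2] := leP (dl / 2) (m (A k)).
    exists P, (w + m (A k)), (c + a), p; split => //.
    - by rewrite mulrDr; have := close _ A2; lra.
    - by rewrite WS addrAC lerD2r.
    - by rewrite big_ord_recr /= sE addrAC.
  (* Both sets have measure below dl/2, so [hdl] applies to their union, which can remain
     pending. *)
  have mPA : measurable (P `|` A k) by exact: measurableU.
  have PA1 : nint (P `|` A k) g <= 1.
    apply: hdl => //; rewrite -mE// m_setU// lte_fin.
    by move: P2 A2; lra.
  rewrite nint_setU// in PA1.
  have pP : p <= nint P g by case: hp => -[] // _; rewrite leNgt P2.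
  exists (P `|` A k), w, c, (p + a); split => //.
  - by rewrite subUset.
  - by rewrite m_setU// WS; move: wP; lra.
  - by rewrite big_ord_recr /= sE addrA.
  - by left; rewrite nint_setU//; split; lra.
have [P [w [c [p [[mP PW] cw wP -> hp]]]]] := inv n (leqnn n).
have p1 : p <= 1 by case: hp => -[].
apply: lerD => //; apply: le_trans cw _; rewrite ler_wpM2l//.
have := m_ge0 mP; have : m (W n) <= m setT.
  by apply: fine_le; rewrite ?m_fin//; apply: le_measure; rewrite ?inE.
by move: wP; lra.
Qed.

Variable F : set (set T).
Hypothesis mF : forall A, F A -> measurable A.
Hypothesis entF : uniform_entropy F.

(** Equi-integrability bounds the errors made by passing to representatives, and finitely many
    functionals control the representatives. [C] is fixed before [th], as [norm_sum_small]
    requires. *)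
Lemma weakly_compact_local_bounds (K : set L1) (f0 : L1) : weakly_compact K -> K f0 ->
  exists2 C, 0 <= C & forall th : R, 0 < th ->
    exists (s : seq (dual L1)) (r : R), 0 < r /\
    forall f, K f -> (forall G, G \in s -> `|G f - G f0| < r) ->
      (forall A, F A -> `|sint A (f - f0)| <= th) /\
      (forall n (A : nat -> set T), (forall i, measurable (A i)) ->
        trivIset setT A -> (forall i, (i < n)%N -> F (A i)) ->
        \sum_(i < n) `|sint (A i) (f - f0)| <= C).
Proof.
move=> cK Kf0; have eK := weakly_compact_equi_integrable mu_fin cK.
have [d1 d10 hd1] := eK (1 / 2) ltac:(by rewrite divr_gt0).
exists (2 / d1 * m setT + 1); first by rewrite addr_ge0// mulr_ge0// ?m_ge0// divr_ge0// ltW.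
(* The cap at 1 meets the hypothesis of [sum_sint_le] on the individual integrals. *)
move=> th th0; pose th' := Num.min th 1.
have th'0 : 0 < th' by rewrite lt_min th0 ltr01.
(* Mass th'/8 for each of [f] and [f0] gives th'/4 on each of the two differences; the
   representative accounts for the remaining th'/2. *)
have [d2 d20 hd2] := eK (th' / 8) ltac:(by rewrite divr_gt0).
have d22 : 0 < d2 / 2 by rewrite divr_gt0.
have [n hn] := entF (m setT) d22.
have [rep [mrep hrep]] := hn m m_ge0 m_setU (lexx _).
have /choice[G hG] i := sint_dual (mrep i).
exists [seq G i | i <- enum 'I_n], (th' / 2); split; first by rewrite divr_gt0.
move=> f Kf fs.
have sm A : F A -> `|sint A (f - f0)| <= th'.
  move=> FA; have mA := mF FA; have [i hi] := hrep A FA.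
  apply: le_trans (sint_diff _ mA (mrep i)) _.
  have h1 : `|sint (rep i) (f - f0)| < th' / 2.
    by rewrite sintB// -!hG; apply: fs; apply: map_f; rewrite mem_enum.
  have mD : measurable (A `\` rep i) by exact: measurableD.
  have mD' : measurable (rep i `\` A) by exact: measurableD.
  have small B : measurable B -> m B <= d2 / 2 -> nint B (f - f0) <= th' / 4.
    move=> mB Bd; apply: le_trans (nintB _ _ mB) _.
    have Bd' : (mu B < d2%:E)%E.
      by rewrite -mE// lte_fin (le_lt_trans Bd)// ltr_pdivrMr// mulr2n mulrDr mulr1 ltrDl.
    by have := hd2 _ _ mB Bd' Kf; have := hd2 _ _ mB Bd' Kf0; lra.
  have h2 := small _ mD ltac:(by have := m_ge0 mD'; lra).
  have h3 := small _ mD' ltac:(by have := m_ge0 mD; lra).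
  by move: h1 h2 h3; lra.
split; first by move=> A /sm/le_trans; apply; rewrite ge_min lexx.
move=> k A mA tA FA; apply: sum_sint_le => //.
  move=> B mB Bd; apply: le_trans (nintB _ _ mB) _.
  by have := hd1 _ _ mB Bd Kf; have := hd1 _ _ mB Bd Kf0; lra.
by move=> i ik; apply: le_trans (sm _ (FA i ik)) _; rewrite ge_min lexx orbT.
Qed.

End SetFamily.

(** * Failure of lower bounds on infinite-dimensional subspaces *)

Section LowerBound.
Context d (T : measurableType d) (R : realType).
Variable mu : {measure set T -> \bar R}.
Local Notation L1 := (LspaceType1 mu).
Hypothesis mu_fin : (mu setT < +oo)%E.
Variable F : set (set T).
Hypothesis mF : forall A, F A -> measurable A.
Hypothesis entF : uniform_entropy R F.
Variable Y : {pred L1}.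
Hypothesis sY : submod_closed Y.

Lemma nint_parallelogram A (u v : L1) : measurable A ->
  2 * nint A u <= nint A (u + v) + nint A (u - v).
Proof.
move=> mA; apply: le_trans (nintD _ _ mA).
have -> : u + v + (u - v) = 2 *: u.
  by rewrite addrACA subrr addr0 scaler_nat mulr2n.
by rewrite nintZ// normr_nat.
Qed.

(* One of [g + f k] and [g - f k] does at least as well as their average, for
   which the parallelogram identity controls the quadratic term. *)
Lemma exists_signs (f : nat -> L1) (B : nat -> set T) (N : nat)
    (rep : 'I_N -> set T) (r th q : R) k :
  (forall i, f i \in Y) -> (forall i, `|f i| <= 1) ->
  (forall i, measurable (B i)) -> (forall i, r <= nint (B i) (f i)) ->
  (forall i, measurable (rep i)) -> 0 <= th -> 0 <= q ->
  exists2 g, g \in Y &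
    (forall A, measurable A -> nint A g <= \sum_(i < k) nint A (f i)) /\
    k%:R * (th * r - q * N%:R) <=
      th * (\sum_(i < k) nint (B i) g) - q * (\sum_(i < N) sint (rep i) g ^+ 2).
Proof.
move=> fY f1 mB rB mrep th0 q0; have [Y0 Ylin] := sY.
elim: k => [|k [g gY [gf IH]]].
  exists 0 => //; split.
    by move=> A mA; rewrite big_ord0 -(scale0r 0) nintZ// normr0 mul0r.
  rewrite !big_ord0 mulr0 mul0r sub0r big1 ?mulr0 ?oppr0// => i _.
  by rewrite -(scale0r 0) -[_ *: _]addr0 sint_linear// mul0r add0r -(subrr 0) sintB// subrr expr0n.
pose S (h : L1) := \sum_(i < k.+1) nint (B i) h.
pose Q (h : L1) := \sum_(i < N) sint (rep i) h ^+ 2.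
pose P h := th * S h - q * Q h.
(* The parallelogram identity for squares of reals, with each integral of [f k] at most 1 in
   absolute value. *)
have Qs : Q (g + f k) + Q (g - f k) <= 2 * Q g + 2 * N%:R.
  have fk1 i : `|sint (rep i) (f k)| <= 1.
    by apply: le_trans (sint_le_nint _ (mrep i)) _; exact: le_trans (nint_le_norm _ (mrep i)) (f1 k).
  rewrite /Q -big_split /=.
  apply: le_trans (_ : _ <= \sum_(i < N) (2 * sint (rep i) g ^+ 2 + 2)) _.
    apply: ler_sum => i _; rewrite sintD// sintB//; have := fk1 i.
    by rewrite ler_norml => /andP[]; move: (sint _ _) (sint _ _) => x y; nra.
  by rewrite big_split /= -mulr_sumr sumr_const card_ord mulr_natr.
have Ss : 2 * (\sum_(i < k) nint (B i) g) + 2 * r <= S (g + f k) + S (g - f k).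
  rewrite /S !big_ord_recr /= addrACA -big_split /=; apply: lerD.
    by rewrite mulr_sumr; apply: ler_sum => i _; exact: nint_parallelogram.
  have := nint_parallelogram (f k) g (mB k).
  rewrite [f k + g]addrC -[f k - g]opprB nintN//.
  by have := rB k; lra.
have PP : 2 * (k.+1%:R * (th * r - q * N%:R)) <= P (g + f k) + P (g - f k).
  have := ler_wpM2l th0 Ss; have := ler_wpM2l q0 Qs; move: IH.
  by rewrite /P /Q -natr1; lra.
have res (h : L1) : h \in Y ->
    (forall A, measurable A -> nint A h <= nint A g + nint A (f k)) ->
    k.+1%:R * (th * r - q * N%:R) <= P h ->
  exists2 g, g \in Y &
    (forall A, measurable A -> nint A g <= \sum_(i < k.+1) nint A (f i)) /\
    k.+1%:R * (th * r - q * N%:R) <=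
      th * (\sum_(i < k.+1) nint (B i) g) - q * (\sum_(i < N) sint (rep i) g ^+ 2).
  move=> hY hle hP; exists h => //; split => // A mA.
  by rewrite big_ord_recr /=; apply: le_trans (hle A mA) _; rewrite lerD2r gf.
have [Pp|Pp] := leP (k.+1%:R * (th * r - q * N%:R)) (P (g + f k)).
  apply: (res _ _ _ Pp); first by rewrite addrC -[f k]scale1r Ylin.
  by move=> A mA; exact: nintD.
apply: (res (g - f k)).
- by rewrite addrC -scaleN1r Ylin.
- by move=> A mA; exact: nintB.
- by move: PP Pp; lra.
Qed.

Lemma no_lower_bound_sint (th : R) : infinite_dimensional Y -> 0 < th ->
  ~ (forall f s, f \in Y -> 0 <= s -> (forall A, F A -> `|sint A f| <= s) -> th * `|f| <= s).
Proof.
move=> infY th0 lowb; have [Y0 Ylin] := sY.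
pose m (A : set T) : R := fine (mu A).
have m_fin A : measurable A -> mu A \is a fin_num.
  by move=> mA; apply: lty_fin_num_fun.
have mE A : measurable A -> (m A)%:E = mu A.
  by move=> mA; rewrite /m fineK// m_fin.
have m_ge0 A : measurable A -> 0 <= m A.
  by move=> mA; rewrite -lee_fin mE.
have m_setU A B : measurable A -> measurable B -> A `&` B = set0 ->
    m (A `|` B) = m A + m B.
  move=> mA mB AB; apply: EFin_inj; rewrite EFinD !mE ?measureU//.
  exact: measurableU.
have [eqY|] := pselect (equi_integrable [set f : L1 | f \in Y /\ `|f| <= 1]).
  (* Two differences of mass at most th/4 give th/2 < th for a unit vector with zero integral over
     the representatives. *)
  have [dl dl0 hdl] := eqY (th / 4) ltac:(by rewrite divr_gt0).
  have dl2 : 0 < dl / 2 by rewrite divr_gt0.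
  have [n hn] := entF (m setT) dl2.
  have [rep [mrep hrep]] := hn m m_ge0 m_setU (lexx _).
  have /choice[G hG] i := sint_dual mu (mrep i).
  have [f fY [f0 Gf]] := infinite_dimensional_kernel [seq G i | i <- enum 'I_n] sY infY.
  have nf : `|f| != 0 by rewrite normr_eq0.
  pose g := `|f|^-1 *: f.
  have gY : g \in Y by rewrite /g -[_ *: _]addr0 Ylin.
  have g1 : `|g| = 1 by rewrite normrZ normfV normr_id mulVf.
  have : th * `|g| <= th / 2.
    apply: lowb => // [|A FA]; first by rewrite divr_ge0// ltW.
    have mA := mF FA; have [i hi] := hrep A FA.
    apply: le_trans (sint_diff _ mA (mrep i)) _.
    have -> : sint (rep i) g = 0.
      by rewrite -hG linearZ /= Gf ?scaler0// map_f// mem_enum.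
    have mD : measurable (A `\` rep i) by exact: measurableD.
    have mD' : measurable (rep i `\` A) by exact: measurableD.
    have small B : measurable B -> m B <= dl / 2 -> nint B g <= th / 4.
      move=> mB Bd; apply/ltW/hdl => //; last by split => //=; rewrite g1.
      by rewrite -mE// lte_fin (le_lt_trans Bd)// ltr_pdivrMr// mulr2n mulrDr mulr1 ltrDl.
    have h2 := small _ mD ltac:(by have := m_ge0 _ mD'; lra).
    have h3 := small _ mD' ltac:(by have := m_ge0 _ mD; lra).
    by rewrite normr0; move: h2 h3; lra.
  by rewrite g1 mulr1; move: th0; lra.
move=> /not_equi_integrable_bumps[r [f [B [r0 fK mB tB rB]]]].
pose dl := th * r / 4; have dl0 : 0 < dl by rewrite divr_gt0// mulr_gt0.
have [N hN] := entF 1 dl0.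
(* [N] depends on [dl] and on the mass bound 1 alone, so [n] can be taken large after it even though
   [nu] depends on [n]. *)
pose n := (Num.truncn (N%:R / dl / (th * r / 2))).+1.
have n0 : 0 < n%:R :> R by rewrite ltr0n.
have hn : N%:R / dl < n%:R * (th * r / 2).
  by rewrite -ltr_pdivrMr ?divr_gt0 ?mulr_gt0//; exact: truncnS_gt.
pose nu A : R := n%:R^-1 * \sum_(i < n) nint A (f i).
have [| | |rep [mrep hrep]] := hN nu.
- move=> A mA; rewrite mulr_ge0 ?invr_ge0// sumr_ge0// => i _; exact: nint_ge0.
- move=> A A' mA mA' AA'; rewrite /nu -mulrDr -big_split /=; congr (_ * _).
  by apply: eq_bigr => i _; rewrite nint_setU.
- rewrite /nu ler_pdivrMl// mulr1.
  apply: le_trans (_ : _ <= \sum_(i < n) 1) _; last by rewrite sumr_const card_ord.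
  by apply: ler_sum => i _; rewrite nint_setT; case: (fK i).
(* The weight [q] is 1/t for t = n dl, to match the inequality x <= t + x^2/t used below. *)
have q0 : 0 <= (n%:R * dl)^-1 by rewrite invr_ge0 mulr_ge0// ltW.
have [g gY [gf Pg]] := exists_signs n (fun i => (fK i).1) (fun i => (fK i).2)
  mB rB mrep (ltW th0) q0.
set Qg := \sum_(i < N) _ in Pg.
have Bg : th * (\sum_(i < n) nint (B i) g) <= th * `|g|.
  by rewrite ler_pM2l//; exact: nint_sum.
have : th * `|g| <= 2 * (n%:R * dl) + (n%:R * dl)^-1 * Qg.
  apply: lowb => // [|A FA].
    have Q0 : 0 <= Qg by apply: sumr_ge0 => i _; exact: sqr_ge0.
    by apply: addr_ge0; apply: mulr_ge0 => //; apply: mulr_ge0 => //; exact: ltW.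
  have mA := mF FA; have [i hi] := hrep A FA.
  apply: le_trans (sint_diff _ mA (mrep i)) _.
  (* The mass of [g] on a set is at most [n] times its [nu]-value, whatever the signs. *)
  have h1 : nint (A `\` rep i) g + nint (rep i `\` A) g <= n%:R * dl.
    apply: le_trans (lerD (gf _ _) (gf _ _)) _; [exact: measurableD..|].
    by move: hi; rewrite /nu -mulrDr ler_pdivrMl.
  have h2 : (n%:R * dl)^-1 * sint (rep i) g ^+ 2 <= (n%:R * dl)^-1 * Qg.
    rewrite ler_wpM2l// /Qg (bigD1 i)//= lerDl sumr_ge0// => j _; exact: sqr_ge0.
  have h3 : `|sint (rep i) g| <= n%:R * dl + (n%:R * dl)^-1 * sint (rep i) g ^+ 2.
    rewrite -(real_normK (num_real (sint _ _))); have := normr_ge0 (sint (rep i) g).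
    move: (`|_|) => x x0.
    have t0 : 0 < n%:R * dl by rewrite mulr_gt0.
    move: (n%:R * dl) t0 => t t0.
    rewrite -subr_ge0.
    have -> : t + t^-1 * x ^+ 2 - x = t^-1 * (t ^+ 2 + x ^+ 2 - t * x).
      by field; rewrite gt_eqF.
    rewrite mulr_ge0 ?invr_ge0 ?(ltW t0)//.
    by have := sqr_ge0 (t - x); nra.
  by move: h1 h2 h3; lra.
(* The terms in [Qg] cancel, leaving n th r - N/dl <= n th r / 2 against the choice of [n]. *)
have -> : 2 * (n%:R * dl) = n%:R * (th * r) / 2 by rewrite /dl; field.
have qN : n%:R * ((n%:R * dl)^-1 * N%:R) = N%:R / dl.
  by field; rewrite !gt_eqF.
rewrite mulrBr qN in Pg; move: Pg Bg hn.
by move: (_^-1 * Qg) (N%:R / dl) (th * `|g|) => z w v; lra.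
Qed.

End LowerBound.

(** * Boxes *)

Section FinitelyAdditive.
Context d (T : measurableType d) (R : realType) (nu : set T -> R).
Hypothesis nu_ge0 : forall A, measurable A -> 0 <= nu A.
Hypothesis nu_setU : forall A B, measurable A -> measurable B -> A `&` B = set0 ->
  nu (A `|` B) = nu A + nu B.

Lemma additive_set0 : nu set0 = 0.
Proof.
have : nu (set0 `|` set0) = nu set0 + nu set0 by apply: nu_setU => //; rewrite setI0.
by rewrite setU0; lra.
Qed.

Lemma additive_setD A B : measurable A -> measurable B -> A `<=` B ->
  nu (B `\` A) = nu B - nu A.
Proof.
move=> mA mB AB; have mD : measurable (B `\` A) by exact: measurableD.
have AD : A `&` (B `\` A) = set0 by rewrite setDE setICA setICr setI0.
by have := nu_setU mA mD AD; rewrite (setDUK AB) => ->; rewrite addrAC subrr add0r.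
Qed.

Lemma additive_le A B : measurable A -> measurable B -> A `<=` B -> nu A <= nu B.
Proof.
move=> mA mB AB; rewrite -subr_ge0 -additive_setD//.
by apply: nu_ge0; exact: measurableD.
Qed.

Lemma additive_setU_le A B : measurable A -> measurable B ->
  nu (A `|` B) <= nu A + nu B.
Proof.
move=> mA mB; have mAB : measurable (A `|` B) by exact: measurableU.
rewrite -lerBlDl -(additive_setD mA mAB (@subsetUl _ A B)).
apply: additive_le => //; first exact: measurableD.
by move=> x [[]].
Qed.

Lemma additive_bigsetU_le n (S : 'I_n -> set T) (r : R) :
  (forall i, measurable (S i)) -> (forall i, nu (S i) <= r) ->
  nu (\big[setU/set0]_(i < n) S i) <= n%:R * r.
Proof.
elim: n S => [|n IH] S mS Sr; first by rewrite big_ord0 mul0r additive_set0.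
rewrite big_ord_recr /= -natr1 mulrDl mul1r.
apply: le_trans (additive_setU_le _ (mS _)) _; first exact: bigsetU_measurable.
by apply: lerD => //; apply: IH.
Qed.

(** For nested sets the difference is either empty or has the difference of the values. *)
Lemma additive_chain_diff A B (r : R) : measurable A -> measurable B ->
  A `<=` B \/ B `<=` A -> 0 <= r -> `|nu A - nu B| <= r -> nu (A `\` B) <= r.
Proof.
move=> mA mB [AB|BA] r0 h.
  by rewrite (_ : A `\` B = set0) ?additive_set0// setD_eq0.
by rewrite additive_setD//; apply: le_trans (ler_norm _) h.
Qed.

End FinitelyAdditive.

(** Equal roundings to multiples of [r]; the bound [C] keeps [inord] within its range. *)
Lemma truncn_inord_close (R : realType) (C r x y : R) : 0 < r ->
  0 <= x <= C -> 0 <= y <= C ->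
  inord (Num.truncn (x / r)) = inord (Num.truncn (y / r)) :> 'I_(Num.truncn (C / r)).+1 ->
  `|x - y| <= r.
Proof.
move=> r0 /andP[x0 xC] /andP[y0 yC] /(congr1 val) /=.
have lt z : z <= C -> (Num.truncn (z / r) < (Num.truncn (C / r)).+1)%N.
  move=> zC; rewrite ltnS truncn_le_nat; apply: le_lt_trans (truncnS_gt _).
  by rewrite ler_pM2r ?invr_gt0.
rewrite !inordK ?lt// => E.
have := truncn_itv (divr_ge0 x0 (ltW r0)); have := truncn_itv (divr_ge0 y0 (ltW r0)).
rewrite E -natr1 !ler_pdivlMr// !ltr_pdivrMr// mulrDl mul1r ler_norml.
by move=> /andP[? ?] /andP[? ?]; apply/andP; split; lra.
Qed.

(** * Entropy of the family of boxes *)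

Section Boxes.
Context (R : realType) (n : nat).
Local Notation rV := (g_sigma_algebraType (@open 'rV[R]_n)).

Lemma measurable_coord_lt (i : 'I_n) (t : R) :
  measurable ([set x | x ord0 i < t] : set rV).
Proof.
apply: open_measurable_rV.
apply: (@open_comp _ _ (fun x : 'rV[R]_n => x ord0 i) [set y | y < t]).
  by move=> x _; exact: coord_continuous.
exact: open_lt.
Qed.

Lemma measurable_coord_le (i : 'I_n) (t : R) :
  measurable ([set x | x ord0 i <= t] : set rV).
Proof.
rewrite [X in measurable X](_ : _ = ~` [set x : rV | t < x ord0 i]); last first.
  by apply/seteqP; split => x /=; rewrite leNgt => /negP.
apply: measurableC; apply: open_measurable_rV.
apply: (@open_comp _ _ (fun x : 'rV[R]_n => x ord0 i) [set y | t < y]).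
  by move=> x _; exact: coord_continuous.
exact: open_gt.
Qed.

Lemma measurable_open_box (a b : 'rV[R]_n) : measurable (open_box a b : set rV).
Proof.
rewrite [X in measurable X](_ : _ = \bigcap_(i in [set: 'I_n])
    ([set x : rV | x ord0 i < b ord0 i] `\` [set x : rV | x ord0 i <= a ord0 i])); last first.
  apply/seteqP; split => x /= h i => [_|].
    by have /andP[ax xb] := h i; split => //=; apply/negP; rewrite -ltNge.
  by have [/= xb /negP] := h i Logic.I; rewrite -ltNge => ->.
apply: fin_bigcap_measurable => // i _; apply: measurableD.
  exact: measurable_coord_lt.
exact: measurable_coord_le.
Qed.

Section Key.
Variables (nu : set rV -> R) (C r : R).
Hypothesis r0 : 0 < r.
Hypothesis nu_ge0 : forall A, measurable A -> 0 <= nu A.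
Hypothesis nu_setU : forall A B, measurable A -> measurable B -> A `&` B = set0 ->
  nu (A `|` B) = nu A + nu B.
Hypothesis nuC : nu setT <= C.
Local Notation M := (Num.truncn (C / r)).+1.

(* Two boxes with the same key differ by a set covered by 2n slabs of
   [nu]-measure at most r. *)
Definition box_key (a b : 'rV[R]_n) : {ffun 'I_n -> 'I_M * 'I_M} :=
  [ffun i => (inord (Num.truncn (nu [set x | x ord0 i <= a ord0 i] / r)),
              inord (Num.truncn (nu [set x | x ord0 i < b ord0 i] / r)))].

Lemma box_key_diff (a b a' b' : 'rV[R]_n) : box_key a b = box_key a' b' ->
  nu (open_box a b `\` open_box a' b') <= n%:R * (2 * r).
Proof.
move=> E.
pose lo (i : 'I_n) (t : R) : set rV := [set x | x ord0 i <= t].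
pose lt (i : 'I_n) (t : R) : set rV := [set x | x ord0 i < t].
have mlo i t : measurable (lo i t) by exact: measurable_coord_le.
have mlt i t : measurable (lt i t) by exact: measurable_coord_lt.
have bnd A : measurable A -> 0 <= nu A <= C.
  move=> mA; rewrite nu_ge0//=; apply: le_trans nuC.
  exact: (additive_le nu_ge0 nu_setU).
have lo_total i s t : lo i s `<=` lo i t \/ lo i t `<=` lo i s.
  have [st|/ltW ts] := leP s t; [left|right] => x; rewrite /lo /=; first by move/le_trans; apply.
  by move/le_trans; apply.
have lt_total i s t : lt i s `<=` lt i t \/ lt i t `<=` lt i s.
  have [st|/ltW ts] := leP s t; [left|right] => x; rewrite /lt /=; first by move/lt_le_trans; apply.
  by move/lt_le_trans; apply.
(* A point of the first box outside the second violates an inequality in some coordinate [i], hence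
   lies in the slab [S i]. *)
pose S i := (lo i (a' ord0 i) `\` lo i (a ord0 i)) `|` (lt i (b ord0 i) `\` lt i (b' ord0 i)).
have mS i : measurable (S i) by apply: measurableU; exact: measurableD.
have Sr i : nu (S i) <= 2 * r.
  have := congr1 (fun k : {ffun _ -> _} => k i) E; rewrite !ffunE => -[Ea Eb].
  rewrite mulr_natl mulr2n.
  apply: le_trans (additive_setU_le nu_ge0 nu_setU _ _) _; [exact: measurableD..|].
  apply: lerD.
    apply: (additive_chain_diff nu_setU (mlo _ _) (mlo _ _) (lo_total _ _ _) (ltW r0)).
    rewrite distrC.
    exact: (truncn_inord_close r0 (bnd _ (mlo _ _)) (bnd _ (mlo _ _)) Ea).
  apply: (additive_chain_diff nu_setU (mlt _ _) (mlt _ _) (lt_total _ _ _) (ltW r0)).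
  exact: (truncn_inord_close r0 (bnd _ (mlt _ _)) (bnd _ (mlt _ _)) Eb).
apply: le_trans (additive_bigsetU_le nu_ge0 nu_setU mS Sr).
apply: (additive_le nu_ge0 nu_setU).
- by apply: measurableD; exact: measurable_open_box.
- exact: bigsetU_measurable.
move=> x [xab nx].
have [i hi] : exists i, ~ (a' ord0 i < x ord0 i < b' ord0 i) by exact/existsNP.
rewrite (bigD1 i)//=; left; have /andP[ai bi] := xab i.
move/negP: hi; rewrite negb_and -!leNgt => /orP[xa|xb]; [left|right]; split => //=.
  by apply/negP; rewrite -ltNge.
by apply/negP; rewrite -leNgt.
Qed.

End Key.

(** One representative per key: the number of keys depends on [C], [r] and the dimension, not on
    [nu]. *)
Lemma parallelepipeds_entropy (Omega : set 'rV[R]_n) :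
  @uniform_entropy _ rV R (parallelepipeds Omega).
Proof.
(* The symmetric difference costs 4 n r <= dl; the [+ 1] covers dimension 0. *)
move=> C dl dl0; pose r := dl / (4 * n%:R + 1).
have n4 : 0 < 4 * n%:R + 1 :> R by rewrite ltr_wpDl// mulr_ge0.
have r0 : 0 < r by rewrite divr_gt0.
pose K := {ffun 'I_n -> 'I_(Num.truncn (C / r)).+1 * 'I_(Num.truncn (C / r)).+1}.
exists #|K| => nu nu_ge0 nu_setU nuC.
have /choice[rep hrep] (j : 'I_#|K|) : exists B : set rV, measurable B /\
    forall a b, box_key nu C r a b = enum_val j ->
      nu (open_box a b `\` B) + nu (B `\` open_box a b) <= dl.
  have [[[a' b'] E']|nE] := pselect (exists ab, box_key nu C r ab.1 ab.2 = enum_val j :> K).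
    exists (open_box a' b'); split; first exact: measurable_open_box.
    move=> a b E; have EE := etrans E (esym E').
    apply: le_trans (lerD (box_key_diff r0 nu_ge0 nu_setU nuC EE)
      (box_key_diff r0 nu_ge0 nu_setU nuC (esym EE))) _.
    have -> : n%:R * (2 * r) + n%:R * (2 * r) = (4 * n%:R) * r by ring.
    by rewrite /r mulrA ler_pdivrMr// mulrDr mulr1 mulrC lerDl ltW.
  by exists set0; split => // a b E; case: nE; exists (a, b).
exists rep; split; first by move=> i; have [] := hrep i.
move=> _ [a [b [_ -> _]]]; exists (enum_rank (box_key nu C r a b : K)).
by have [_] := hrep (enum_rank (box_key nu C r a b : K)); apply; rewrite enum_rankK.
Qed.

Lemma bounded_lebesgue_lty (Omega : set 'rV[R]_n) : open Omega ->
  bounded_set Omega -> (lebesgue_rV Omega < +oo)%E.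
Proof.
move=> oO [M [_ hM]].
pose a : 'rV[R]_n := const_mx (- (`|M| + 2)); pose b : 'rV[R]_n := const_mx (`|M| + 2).
have Ob : Omega `<=` open_box a b.
  move=> x Ox i; rewrite !mxE -ltr_norml.
  have xM : `|x| <= `|M| + 1 by apply: hM => //; have := ler_norm M; lra.
  have : `|x ord0 i| <= `|x|.
    by rewrite [leRHS]/Num.norm /= mx_normrE; apply/bigmax_geP; right => /=; exists (ord0, i).
  by move: xM; lra.
apply: le_lt_trans (_ : lebesgue_rV (open_box a b) < +oo)%E.
  apply: le_measure; rewrite ?inE//; first exact: open_measurable_rV.
  exact: measurable_open_box.
rewrite lebesgue_rV_open_box ?ltry// => i; rewrite !mxE.
by have := normr_ge0 M; lra.
Qed.

End Boxes.

(** * The space JF_X *)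

(** The inverse [S] is a mere function, but its continuity at 0 and the homogeneity of [T] suffice:
    a unit vector with too small an image would have norm below 1. *)
Lemma isomorphism_lower_bound (R : realType) (E F : normedModType R)
    (T : {linear E -> F}) (Y : {pred E}) : submod_closed Y ->
  isomorphism_onto_image T Y ->
  exists2 c : R, 0 < c & forall x, x \in Y -> c * `|x| <= `|T x|.
Proof.
move=> [Y0 Ylin] [_ [S [TS /subspace_continuousP cS]]].
have S0 : S 0 = 0 by rewrite -(linear0 T) TS.
have TY0 : (T @` [set` Y]) 0 by exists 0; rewrite ?linear0.
have := cS 0 TY0; rewrite /from_subspace S0 => /cvgrPdist_lt/(_ 1 ltr01).
move=> /nbhs_ballP[r /= r0 hr]; exists (r / 2); first by rewrite divr_gt0.
move=> x xY; rewrite leNgt; apply/negP => Tx.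
have x0 : 0 < `|x|.
  by rewrite normr_gt0; apply: contraTneq Tx => ->; rewrite linear0 !normr0 mulr0 ltxx.
pose y := `|x|^-1 *: x.
have yY : y \in Y by rewrite /y -[_ *: _]addr0 Ylin.
have y1 : `|y| = 1 by rewrite normrZ normfV normr_id mulVf ?gt_eqF.
have Ty : `|T y| < r.
  rewrite linearZ normrZ normfV normr_id mulrC ltr_pdivrMr//.
  by apply: lt_le_trans Tx _; rewrite ler_pM2r// ler_pdivrMr// mulr2n mulrDr mulr1 lerDl ltW.
have := hr (T y); rewrite -ball_normE /= sub0r normrN => /(_ Ty (ex_intro2 _ _ y yY erefl)).
by rewrite TS// sub0r normrN y1 ltxx.
Qed.

Section JamesFunctionSpace.
Context (R : realType) (X : completeNormedModType R) (e : nat -> X)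
  (d0 : nat) (Omega : set 'rV[R]_d0) (oO : open Omega)
  (JF : completeNormedModType R) (I : {linear L1_on oO -> JF}).
Hypothesis I_norm : forall f, `|I f|%:E = JFnorm e f.
Local Notation rV := (g_sigma_algebraType (@open 'rV[R]_d0)).
Local Notation mu := (mrestr (@lebesgue_rV R d0) (open_measurable_rV oO)).
Local Notation boxes := (parallelepipeds Omega : set (set rV)).

Lemma measurable_parallelepiped (A : set rV) : boxes A -> measurable A.
Proof. by move=> [a [b [_ -> _]]]; exact: measurable_open_box. Qed.

(** Passes from finite families to sequences and from Lebesgue measure to its restriction, the two
    measures agreeing inside [Omega]. *)
Lemma JF_norm_le (f : L1_on oO) (s : R) :
  (forall m (A : nat -> set rV), (forall i, measurable (A i)) -> trivIset setT A ->
    (forall i, (i < m)%N -> boxes (A i)) ->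
    `|\sum_(i < m) sint (mu := mu) (A i) f *: e i| <= s) ->
  `|I f| <= s.
Proof.
move=> hs; rewrite -lee_fin I_norm; apply: ge_ereal_sup => _ [m [T [Tbox tT ->]]].
(* Padding by the empty set preserves measurability and disjointness. *)
pose A i : set rV := oapp T set0 (insub i).
have AE (i : 'I_m) : A i = T i by rewrite /A valK.
have Abox i : (i < m)%N -> boxes (A i).
  by move=> im; rewrite (AE (Ordinal im)); exact: Tbox.
rewrite lee_fin; have := hs m A; rewrite (eq_bigr (fun i : 'I_m =>
  (\int[@lebesgue_rV R d0]_(x in T i) L1fun f x) *: e i)); last first.
  move=> i _; congr (_ *: _); rewrite AE /sint; congr fine.
  symmetry; apply: (eq_measure_integral mu) => B mB BT.
  rewrite /= /mrestr setIidl//.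
  have [a [b [_ E TO]]] := Tbox i; exact: subset_trans TO.
apply => //.
- move=> i; have [im|mi] := ltnP i m.
    by apply: measurable_parallelepiped; exact: Abox.
  by rewrite /A insubF /=; [exact: measurable0|rewrite ltnNge mi].
- move=> i j _ _; rewrite /A; case: insubP => [i' _ <-|_] /=; last by move=> [x []].
  case: insubP => [j' _ <-|_] /=; last by move=> [x []].
  by move=> ne; rewrite (tT i' j').
Qed.

Hypothesis e_sym : one_symmetric e.

Lemma JF_norm_le_L1 (f : L1_on oO) : `|I f| <= `|e 0%N| * `|f|.
Proof.
apply: JF_norm_le => m A mA tA _.
apply: le_trans (norm_sum_le1 e_sym m (fun i => sint (mu := mu) (A i) f)) _.
rewrite ler_wpM2l//.
apply: le_trans (_ : _ <= \sum_(i < m) nint (A i) f) _; last exact: nint_sum.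
by apply: ler_sum => i _; exact: sint_le_nint.
Qed.

Hypothesis X_refl : reflexive_space X.
Hypothesis e_basis : schauder_basis e.
Hypothesis bO : bounded_set Omega.

Let mu_fin : (mu setT < +oo)%E.
Proof. by rewrite /mrestr setTI; exact: bounded_lebesgue_lty. Qed.

Lemma JF_dunford_pettis : dunford_pettis I.
Proof.
move=> K cK; apply: (@continuous_compact (weak (L1_on oO)) JF I K _ cK).
apply/subspace_continuousP => f0 Kf0; apply/cvgrPdist_le => eps eps0.
(* The order matters: [C] comes from [K], then [th] from [C] and [eps], then the weak neighbourhood
   from [th]. *)
have [C C0 hC] := weakly_compact_local_bounds mu_fin measurable_parallelepiped
  (parallelepipeds_entropy Omega) cK Kf0.
have [th th0 hth] := norm_sum_small X_refl e_basis e_sym C0 eps0.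
have [s [r [r0 hs]]] := hC th th0.
rewrite /=; apply: filterS (weak_nbhs s f0 r0) => f /= fs Kf.
rewrite distrC -linearB; have [h1 h2] := hs f Kf fs.
apply: JF_norm_le => m A mA tA Abox.
apply: (hth m (fun i => sint (mu := mu) (A i) (f - f0))) => [i im|]; last exact: h2.
by apply: h1; exact: Abox.
Qed.

(** If [I] is bounded below by [c] on [Y], no unit vector of [Y] has all its box integrals at most
    [th], as its image would have norm at most c/2; this is the lower bound excluded by
    [no_lower_bound_sint]. *)
Lemma JF_strictly_singular : strictly_singular I.
Proof.
move=> Y sY _ infY /(isomorphism_lower_bound sY)[c c0 hc].
have c2 : 0 < c / 2 by rewrite divr_gt0.
have [th th0 hth] := norm_sum_small X_refl e_basis e_sym (@ler01 R) c2.
apply: (no_lower_bound_sint mu_fin measurable_parallelepiped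
  (parallelepipeds_entropy Omega) sY infY th0) => f s fY s0 fs.
rewrite leNgt; apply/negP => sth; have [Y0 Ylin] := sY.
have [f0|f0] := eqVneq f 0.
  by move: sth; rewrite f0 normr0 mulr0 ltNge s0.
have nf : 0 < `|f| by rewrite normr_gt0.
pose g := `|f|^-1 *: f.
have gY : g \in Y by rewrite /g -[_ *: _]addr0 Ylin.
have g1 : `|g| = 1 by rewrite normrZ normfV normr_id mulVf ?gt_eqF.
have := hc g gY; rewrite g1 mulr1; apply/negP; rewrite -ltNge.
apply: le_lt_trans (_ : _ <= c / 2) _; last by rewrite ltr_pdivrMr// mulr2n mulrDr mulr1 ltrDl.
apply: JF_norm_le => m A mA tA Abox.
apply: (hth m (fun i => sint (mu := mu) (A i) g)) => [i im|]; last first.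
  rewrite -g1.
  apply: le_trans (_ : _ <= \sum_(i < m) nint (A i) g) _; last exact: nint_sum.
  by apply: ler_sum => i _; exact: sint_le_nint.
rewrite -[g]addr0 sint_linear// [sint _ 0](_ : _ = 0) ?addr0.
  rewrite normrM normfV normr_id mulrC ler_pdivrMr//.
  by apply: le_trans (fs _ (Abox i im)) _; exact: ltW.
by rewrite -(subrr f) sintB// subrr.
Qed.

End JamesFunctionSpace.

Theorem corollary1p12 (R : realType)
    (X : completeNormedModType R) (e : nat -> X)
    (d0 : nat) (Omega : set 'rV[R]_d0) (oO : open Omega)
    (JF : completeNormedModType R) (I : {linear L1_on oO -> JF}) :
  reflexive_space X ->
  schauder_basis e ->
  one_symmetric e ->
  Omega !=set0 ->
  bounded_set Omega ->
  is_completion_for (JFnorm e) I ->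
  [/\ continuous I, dunford_pettis I & strictly_singular I].
Proof.
move=> X_refl e_basis e_sym _ bO [I_norm _]; split.
- apply: linear_le_bounded => f; exact: JF_norm_le_L1.
- exact: JF_dunford_pettis.
- exact: JF_strictly_singular.
Qed.
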